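(* Let $p\in(1,2]$. Let $(X_i,Y_i)$, $i=1,\dots,n$, be independent copies of $(X,Y)\in\mathbb{R}^d\times\mathbb{R}$ with $\mathbb{E}\|X\|^2<\infty$, $\mathbb{E}(Y^2)<\infty$, let $\theta_*\in\arg\min_{\theta\in\mathbb{R}^d}\mathbb{E}[(Y-\langle\theta,X\rangle)^2]$, and assume $\mathbb{E}[(Y-\langle\theta_*,X\rangle)^2]>0$, $$\mathbb{E}\bigl[(Y-\langle\theta_*,X\rangle)^{4p+4}\bigr]<\infty\quad\text{and}\quad\mathbb{E}\bigl(\|G^{-1/2}X\|^{4p+4}\bigr)<\infty .$$ Let $\kappa_1,\kappa_2,K,\mu,\widehat\delta$ be as in the context, with $K>1$, and define $$\widetilde\gamma_+=\frac1{p+1}\Bigl(\frac{2[\log(\epsilon^{-1})+0.73(d+1)]}{(K-1)n}\Bigr)^{p/2}(1+\widehat\delta)^{p+1}\Biggl[\Biggl(\frac{\mathbb{E}[(Y-\langle\theta_*,X\rangle)^{2p+2}]^{1/(p+1)}}{\mathbb{E}[(Y-\langle\theta_*,X\rangle)^2]}+\mathbb{E}(\|G^{-1/2}X\|^{2p+2})^{1/(p+1)}\Biggr)^{p+1}$$ $$\qquad+\frac1{\sqrt{n\epsilon}}\Biggl(\frac{\mathbb{E}[(Y-\langle\theta_*,X\rangle)^{4p+4}]^{1/(2p+2)}}{\mathbb{E}[(Y-\langle\theta_*,X\rangle)^2]}+\mathbb{E}(\|G^{-1/2}X\|^{4p+4})^{1/(2p+2)}\Biggr)^{p+1}\Biggr].$$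 Let $\epsilon\in(0,1)$ and assume $$n>\Biggl[20\bigl(\sqrt{\kappa_1}+\sqrt{\kappa_2}\bigr)\sqrt{d+1}+\Bigl(\frac52+\frac1{2(K-1)}\Bigr)\Bigl(2(K-1)\bigl[\log(\epsilon^{-1})+0.73(d+1)\bigr]\Bigr)^{1/2}\Biggr]^2 .$$ Then with probability at least $1-3\epsilon$, for any $(\theta,\xi)\in\mathbb{R}^{d+1}$, $$\left|\frac{\overline N(\theta,\xi)}{N(\theta,\xi)}-1\right|\le\delta:=\frac{\widehat\delta+\widetilde\gamma_+}{(1-\widehat\delta)_+(1-\widetilde\gamma_+)_+},$$ so that in particular, if $\delta<1$, any empirical risk minimizer $\widehat\theta\in\arg\min_{\theta\in\mathbb{R}^d}\sum_{i=1}^n(Y_i-\langle\theta,X_i\rangle)^2$ is such that with probability at least $1-3\epsilon$, $$R(\widehat\theta)-R(\theta_* )\le\frac{\delta^2}{(1-\delta)(1-\delta^2)n}\sum_{i=1}^n(Y_i-\langle\widehat\theta,X_i\rangle)^2\le\frac{\delta^2}{(1-\delta)^2}R(\theta_* ),$$ where $\delta^2=\mathbf{O}_{n\to\infty}(\widehat\delta^2)=\mathbf{O}_{n\to\infty}\Bigl(\frac{(\kappa_1+\kappa_2)[d+\log(\epsilon^{-1})]}{n}\Bigr)$.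
   Context: $R(\theta)=\mathbb{E}[(Y-\langle\theta,X\rangle)^2]$ (evaluated at the random point $\widehat\theta$ for $R(\widehat\theta)$), $G=\mathbb{E}(XX^\top)$, $G^{-1/2}$ is the symmetric square root of the pseudo-inverse of $G$, $(z)_+=\max\{z,0\}$, $N(\theta,\xi)=\mathbb{E}[(\xi Y-\langle\theta,X\rangle)^2]$, $\overline N(\theta,\xi)=\frac1n\sum_{i=1}^n(\xi Y_i-\langle\theta,X_i\rangle)^2$. $\kappa_1=\sup\{\mathbb{E}(\langle\theta,X\rangle^4):\theta\in\mathbb{R}^d,\ \mathbb{E}(\langle\theta,X\rangle^2)\le1\}$, $\kappa_2=\dfrac{\mathbb{E}[(Y-\langle\theta_*,X\rangle)^4]}{\mathbb{E}[(Y-\langle\theta_*,X\rangle)^2]^2}$, $K=(\sqrt{\kappa_1}+\sqrt{\kappa_2})^2$, $$\mu=\Bigl(\frac{2(K-1)}n[\log(\epsilon^{-1})+0.73(d+1)]\Bigr)^{1/2}+6.81(\sqrt{\kappa_1}+\sqrt{\kappa_2})\sqrt{\frac{2(d+1)}n},\qquad\widehat\delta=\frac\mu{1-2\mu}.$$ Conventions: $0/0=1$ and $z/0=+\infty$ for $z>0$ in quotients of quadratic forms; a fraction whose denominator contains a vanishing positive part is $+\infty$. $A=\mathbf{O}_{n\to\infty}(B)$ means $\limsup_{n\to\infty}A/B\le c$ for a numerical constant $c$, the other parameters being fixed. *)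

(* Defs.v *)
From HB Require Import structures.
From mathcomp Require Import all_boot all_order all_algebra.
From mathcomp Require Import all_classical all_reals all_analysis.

Set Implicit Arguments.
Unset Strict Implicit.
Unset Printing Implicit Defensive.

Import Order.TTheory GRing.Theory Num.Theory.
Import numFieldNormedType.Exports.

Local Open Scope classical_set_scope.
Local Open Scope ring_scope.

Definition borelType (V : ptopologicalType) := g_sigma_algebraType (@open V).

(* R^d x R with the product of the Borel sigma-algebras. *)
Definition sample_space (R : realType) (d : nat) :=
  (borelType 'cV[R]_d * R)%type.

(* The library norm `|u| on matrices is the sup norm, hence the Euclidean
   structure is defined here. *)
Definition dot (R : realType) (d : nat) (u v : 'cV[R]_d) : R :=
  (u^T *m v) 0 0.

Definition enorm (R : realType) (d : nat) (u : 'cV[R]_d) : R :=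
  Num.sqrt (dot u u).

Definition argmin (U : Type) (R : realType) (f : U -> R) (x : U) : Prop :=
  forall y, f x <= f y.

(* Moore-Penrose pseudo-inverse. *)
Definition is_pseudo_inverse (R : realType) (d : nat) (A B : 'M[R]_d) : Prop :=
  [/\ A *m B *m A = A, B *m A *m B = B,
      (A *m B)^T = A *m B & (B *m A)^T = B *m A].

(* S = A^{-1/2}: S is symmetric positive semidefinite and S^2 is the
   pseudo-inverse of A. *)
Definition is_sqrt_pseudo_inverse (R : realType) (d : nat) (A S : 'M[R]_d) :
    Prop :=
  [/\ S^T = S, forall u : 'cV[R]_d, 0 <= dot u (S *m u)
    & is_pseudo_inverse A (S *m S)].

(* Quotient of values of nonnegative quadratic forms, with 0 / 0 = 1 and
   a / 0 = +oo for a > 0. *)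
Definition form_quotient (R : realType) (a b : R) : \bar R :=
  if b == 0 then (if a == 0 then 1%E else +oo%E) else (a / b)%:E.

Section probability_notions.
Context {R : realType} {dT : measure_display} {T : measurableType dT}
  (P : probability T R).

(* The set E of favourable outcomes need not be measurable: it is required to
   contain an event of probability at least q. *)
Definition with_probability_at_least (q : R) (E : set T) : Prop :=
  exists A : set T, [/\ measurable A, A `<=` E & (q%:E <= P A)%E].

Definition mutually_independent {dV : measure_display}
    {V : measurableType dV} (I : finType) (Z : I -> {RV P >-> V}) : Prop :=
  forall (J : {set I}) (B : I -> set V), (forall i, measurable (B i)) ->
    P (\bigcap_(i in [set` J]) (Z i @^-1` B i)) =
    (\prod_(i in J) P (Z i @^-1` B i))%E.

Definition independent_copies {dV : measure_display}
    {V : measurableType dV} (I : finType) (Z : I -> {RV P >-> V})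
    (Z0 : {RV P >-> V}) : Prop :=
  mutually_independent Z /\
  (forall i B, measurable B -> distribution P (Z i) B = distribution P Z0 B).

End probability_notions.

(* Finite real expectations; values at random variables without finite
   expectation are irrelevant. *)
Definition rexpectation (R : realType) (dT : measure_display)
    (T : measurableType dT) (P : probability T R) (f : T -> R) : R :=
  fine ('E_P[f])%E.

Section least_squares.
Context {R : realType} {dT : measure_display} {T : measurableType dT}
  (P : probability T R) {d : nat}.
Implicit Types (Z : T -> 'cV[R]_d * R) (theta : 'cV[R]_d) (xi : R).

Definition residual Z theta (w : T) : R := (Z w).2 - dot theta (Z w).1.

Definition risk Z theta : R :=
  rexpectation P (fun w => residual Z theta w ^+ 2).

Definition quad Z theta xi : R :=
  rexpectation P (fun w => (xi * (Z w).2 - dot theta (Z w).1) ^+ 2).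

Definition emp_quad n (Zs : 'I_n -> T -> 'cV[R]_d * R) (w : T) theta xi : R :=
  n%:R^-1 * \sum_(i < n) (xi * (Zs i w).2 - dot theta (Zs i w).1) ^+ 2.

Definition sum_squares n (Zs : 'I_n -> T -> 'cV[R]_d * R) (w : T) theta : R :=
  \sum_(i < n) residual (Zs i) theta w ^+ 2.

Definition gram Z : 'M[R]_d :=
  \matrix_(i, j) rexpectation P (fun w => ((Z w).1 *m ((Z w).1)^T) i j).

Definition kappa1 Z : R :=
  fine (ereal_sup [set 'E_P[fun w => (dot theta (Z w).1 ^+ 4)%R] |
    theta in [set theta | 'E_P[fun w => (dot theta (Z w).1 ^+ 2)%R] <= 1]])%E.

Definition kappa2 Z theta : R :=
  rexpectation P (fun w => residual Z theta w ^+ 4) / risk Z theta ^+ 2.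

Definition kappa_root Z theta : R :=
  Num.sqrt (kappa1 Z) + Num.sqrt (kappa2 Z theta).

Definition kappaK Z theta : R := kappa_root Z theta ^+ 2.

(* log (1 / eps) + 0.73 (d + 1) *)
Definition log_dim (eps : R) : R := ln eps^-1 + 73 / 100 * (d%:R + 1).

Definition mu Z theta (eps : R) (n : nat) : R :=
  Num.sqrt (2 * (kappaK Z theta - 1) / n%:R * log_dim eps)
  + 681 / 100 * kappa_root Z theta * Num.sqrt (2 * (d%:R + 1) / n%:R).

Definition delta_hat Z theta (eps : R) (n : nat) : R :=
  mu Z theta eps n / (1 - 2 * mu Z theta eps n).

(* The exponents 2p+2 and 4p+4 are real, so moments of the residual are moments
   of its absolute value; a `^ q is not meaningful for a < 0. *)
Definition residual_moment Z theta (q : R) : R :=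
  rexpectation P (fun w => `|residual Z theta w| `^ q).

(* Moments of |G^{-1/2} X|, where S stands for G^{-1/2}. *)
Definition white_moment Z (S : 'M[R]_d) (q : R) : R :=
  rexpectation P (fun w => enorm (S *m (Z w).1) `^ q).

Definition gamma_tilde Z theta (S : 'M[R]_d) (p eps : R) (n : nat) : R :=
  (p + 1)^-1
  * (2 * log_dim eps / ((kappaK Z theta - 1) * n%:R)) `^ (p / 2)
  * (1 + delta_hat Z theta eps n) `^ (p + 1)
  * ((residual_moment Z theta (2 * p + 2) `^ (1 / (p + 1)) / risk Z theta
        + white_moment Z S (2 * p + 2) `^ (1 / (p + 1))) `^ (p + 1)
     + (Num.sqrt (n%:R * eps))^-1
       * (residual_moment Z theta (4 * p + 4) `^ (1 / (2 * p + 2))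
            / risk Z theta
          + white_moment Z S (4 * p + 4) `^ (1 / (2 * p + 2))) `^ (p + 1)).

Definition delta Z theta (S : 'M[R]_d) (p eps : R) (n : nat) : \bar R :=
  let dh := delta_hat Z theta eps n in
  let ga := gamma_tilde Z theta S p eps n in
  let D := Num.max (1 - dh) 0 * Num.max (1 - ga) 0 in
  if D == 0 then +oo%E else ((dh + ga) / D)%:E.

End least_squares.

Arguments log_dim {R} d eps.

(* A_n = O(B_n) with constant c, i.e. limsup A_n / B_n <= c. *)
Definition limsup_ratio_le (R : realType) (c : R) (A : nat -> \bar R)
    (B : nat -> R) : Prop :=
  (limn_esup (fun n => A n * ((B n)^-1)%:E) <= c%:E)%E.

(* Main.v *)
Require Import Defs.
From HB Require Import structures.
From mathcomp Require Import all_boot all_order all_algebra.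
From mathcomp Require Import all_classical all_reals all_analysis.
From mathcomp Require Import measurable_realfun ring lra.

Set Implicit Arguments.
Unset Strict Implicit.
Unset Printing Implicit Defensive.
Set SsrOldRewriteGoalsOrder.

Import Order.TTheory GRing.Theory Num.Theory.
Import numFieldNormedType.Exports.

Local Open Scope classical_set_scope.
Local Open Scope ring_scope.

(** The two quadratic forms [quad] and [emp_quad] are compared after whitening.
    Let [r] be the residual of the best linear predictor, [R0 = E r^2] and
    [W = (S X, r / sqrt R0)] in dimension [D = d + 1]. The normal equations make the
    cross term vanish, so that [xi Y - <theta, X>] equals [<u, W>] almost surely for a
    vector [u] whose squared norm is exactly [quad theta xi]. The first claim thus bounds the quadratic form
    [u |-> mean <u, W_i>^2 - E <u, W>^2] by a multiple of [|u|^2]. By Minkowski's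
    inequality in [L^4], [E <u, W>^4 <= K (E <u, W>^2)^2], which is where
    [kappa1], [kappa2] and [K] come from.

    For a fixed [u] in the unit ball put [x = <u, W>^2] and [t = lam (x - E x)] or
    its opposite. The variables are heavy tailed, so instead of the exponential the
    product of the polynomials [1 + t_i + t_i^2 / 2] is controlled: by independence
    its expectation is at most [exp (n lam^2 (K - 1) / 2)], and Markov's inequality
    applies ([chernoff_quadratic]). Since
    [exp (t - t_+^q / (2 q)) <= 1 + t + t^2 / 2] for [2 <= q <= 3]
    ([expR_le_quadratic_powR]), used with [q = p + 1], the sum of the [t_i] is then
    controlled up to the empirical moment of order [p + 1] of [|W|^2]. That moment
    does not depend on [u]; Chebyshev's inequality bounds it at the price of the
    [1 / sqrt (n eps)] term of [gamma_tilde] ([chebyshev_sum]). The three [eps] in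
    [1 - 3 eps] pay for the upper tail, the lower tail, and this moment.

    Uniformity in [u] comes from a net of the unit ball at scale [1 / k]
    ([exists_net]): the difference of the two forms is a genuine symmetric quadratic
    form, hence its norm is at most its maximum on the net divided by [1 - 2 / k]
    ([net_quadratic_form]). The net has at most [2^((k + 2) D)] points. The term
    [6.81 sqrt (2 K D / n)] of [mu] is large enough to pay both for the
    union bound and for the factor [1 - 2 / k], provided that [k] grows like
    [sqrt (log_dim / D)] when [log_dim] dominates [D] ([deviation_le_mu]); the spare
    factor one half in [t_+^q / (2 q)] pays for [1 - 2 / k] in the moment term. This
    gives relative deviation at most [mu + gamma_tilde], which is at most [delta].

    The excess risk bound is deterministic on that event: along the line
    [theta_hat + t (theta_hat - theta_star)] the empirical form is even in [t], and
    comparing it with [quad] at [t] and [- t] for [t = 1 / delta] gives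
    [N <= delta^2 (R0 + N)] for the excess risk [N] ([excess_risk]).

    Finally [mu] is a constant times [n^(-1/2)] while [gamma_tilde] is
    [O (n^(-p/2))] with [p > 1], which yields the asymptotic orders
    ([delta_orders]). *)

(** * Products of functions of independent variables *)

Section ProductFormula.
Local Open Scope ereal_scope.
Context d d' (T : measurableType d) (V : measurableType d') (R : realType)
  (P : {measure set T -> \bar R}).

Import HBNNSimple.

(** Both sides are linear and monotonically continuous in [f], so the case of
    indicators extends to simple functions and then to nonnegative functions. *)
Lemma integral_comp_weight (X : T -> V) (G : T -> R) (c : \bar R)
    (mX : measurable_fun setT X) (mG : measurable_fun setT G)
    (G0 : forall w, (0 <= G w)%R) (cfin : c \is a fin_num) :
  (forall B : set V, measurable B ->
    \int[P]_w (\1_B (X w) * G w)%:E = \int[P]_w (\1_B (X w))%:E * c) ->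
  forall f : V -> R, measurable_fun setT f -> (forall x, (0 <= f x)%R) ->
  \int[P]_w (f (X w) * G w)%:E = \int[P]_w (f (X w))%:E * c.
Proof.
move=> indE f mf f0.
have mfX (h : V -> R) : measurable_fun setT h ->
    measurable_fun setT (EFin \o (h \o X)).
  by move=> mh; apply/measurable_EFinP; exact: measurableT_comp.
have mfXG (h : V -> R) : measurable_fun setT h ->
    measurable_fun setT (EFin \o (fun w => h (X w) * G w)%R).
  move=> mh; apply/measurable_EFinP.
  by apply: measurable_funM => //; exact: measurableT_comp.
have simpleE (h : {nnsfun V >-> R}) :
    \int[P]_w (h (X w) * G w)%:E = \int[P]_w (h (X w))%:E * c.
  have h0 r x : (0 <= r * \1_(h @^-1` [set r]) x)%R.
    by have := nnfun_muleindic_ge0 h r x; rewrite -EFinM lee_fin.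
  have mh r : measurable_fun setT (fun x => r * \1_(h @^-1` [set r]) x)%R.
    exact: measurable_funM.
  have hXG w : (h (X w) * G w)%:E = \sum_(r \in range h)
      (r * \1_(h @^-1` [set r]) (X w) * G w)%:E.
    by rewrite fimfunE fsumEFin// mulr_fsuml.
  under eq_integral do rewrite hXG.
  rewrite ge0_integral_fsum//; last 2 first.
  - by move=> r; apply: (@mfXG (fun x => r * \1_(h @^-1` [set r]) x)%R).
  - by move=> r w _; rewrite lee_fin mulr_ge0.
  under [in RHS]eq_integral do rewrite fimfunE -fsumEFin//.
  rewrite [in RHS]ge0_integral_fsum//; last 2 first.
  - by move=> r; apply: (@mfX (fun x => r * \1_(h @^-1` [set r]) x)%R).
  - by move=> r w _; rewrite lee_fin.
  rewrite ge0_mule_fsuml; last first.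
    by move=> r; apply: integral_ge0 => w _; rewrite lee_fin.
  apply: eq_fsbigr => r _.
  have [r0|r0] := ltP r 0%R.
    rewrite integral0_eq; last by move=> w _; rewrite preimage_nnfun0// indic0 mulr0 mul0r.
    rewrite integral0_eq ?mul0e//.
    by move=> w _; rewrite preimage_nnfun0// indic0 mulr0.
  under eq_integral do rewrite -mulrA EFinM.
  under [in RHS]eq_integral do rewrite EFinM.
  rewrite ge0_integralZl//; last 2 first.
  - by apply: (@mfXG (\1_(h @^-1` [set r]))).
  - by move=> w _; rewrite lee_fin mulr_ge0.
  rewrite ge0_integralZl//; first by rewrite indE// muleA.
  by apply: (@mfX (\1_(h @^-1` [set r]))).
have mfE : measurable_fun setT (EFin \o f) by exact/measurable_EFinP.
pose f_ := nnsfun_approx measurableT mfE.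
have cvf x : (f_ n x)%:E @[n --> \oo] --> (f x)%:E.
  by apply: (cvg_nnsfun_approx measurableT mfE) => // y _; rewrite lee_fin.
have ndf a b x : (a <= b)%N -> (f_ a x <= f_ b x)%R.
  by move=> ab; exact/lefP/nd_nnsfun_approx.
transitivity (limn (fun n => \int[P]_w (f_ n (X w) * G w)%:E)).
  rewrite -monotone_convergence//=.
  - apply: eq_integral => w _; apply/esym/cvg_lim => //=.
    apply: cvg_EFin; first exact: nearW.
    apply: cvgM; last exact: cvg_cst.
    by have /fine_cvg := cvf (X w).
  - by move=> n; exact: mfXG.
  - by move=> n w _; rewrite lee_fin mulr_ge0.
  - by move=> w _ a b ab; rewrite lee_fin ler_wpM2r// ndf.
rewrite (_ : \int[P]_w (f (X w))%:E = limn (fun n => \int[P]_w (f_ n (X w))%:E)).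
  rewrite -limeMr//.
    by congr (limn _); apply/funext => n /=; rewrite simpleE.
  apply/ereal_nondecreasing_is_cvgn => a b ab; apply: ge0_le_integral => //.
  - by move=> w _; rewrite lee_fin.
  - exact: mfX.
  - exact: mfX.
  - by move=> w _; rewrite lee_fin ndf.
rewrite -monotone_convergence//=.
- by apply: eq_integral => w _; apply/esym/cvg_lim => //=.
- by move=> n; exact: mfX.
- by move=> n w _; rewrite lee_fin.
- by move=> w _ a b ab; rewrite lee_fin ndf.
Qed.

End ProductFormula.

Section IndependentProduct.
Context d d' (T : measurableType d) (V : measurableType d') (R : realType)
  (P : probability T R) (I : finType) (Z : I -> {RV P >-> V}).
Local Open Scope ereal_scope.

Lemma integral_prod_indic (B : I -> set V) : mutually_independent Z ->
  (forall i, measurable (B i)) ->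
  \int[P]_w (\prod_i \1_(B i) (Z i w))%:E =
  \prod_i \int[P]_w (\1_(B i) (Z i w))%:E.
Proof.
move=> indep mB.
have mZB i : measurable (Z i @^-1` B i) by exact: measurable_funPTI.
have := indep [set: I]%SET B mB.
have -> : [set` [set: I]%SET] = [set: I].
  by apply/seteqP; split => // i _; rewrite /= inE.
have mcap : measurable (\bigcap_(i in [set: I]) (Z i @^-1` B i)).
  by apply: fin_bigcap_measurable.
rewrite -[X in P X]setIT -integral_indic//.
rewrite (eq_bigl xpredT) => [|i]; last by rewrite inE.
have -> : \int[P]_x (\1_(\bigcap_(i in [set: I]) (Z i @^-1` B i)) x)%:E =
    \int[P]_w (\prod_i \1_(B i) (Z i w))%:E.
  apply: eq_integral => w _; congr EFin; rewrite indicE.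
  have [wB|wB] := pselect (forall i, B i (Z i w)).
    rewrite mem_set => [|i _]; last exact: wB.
    by rewrite big1// => i _; rewrite indicE mem_set.
  have [i wBi] : exists i, ~ B i (Z i w) by apply/existsNP.
  rewrite memNset => [|]; last by move=> /(_ i Logic.I).
  by rewrite (bigD1 i)//= indicE memNset// mul0r.
move=> ->; apply: eq_bigr => i _.
rewrite -[X in P X]setIT -integral_indic//.
Qed.

(** Independence of events is the case where all factors are indicators. The
    factors are freed one at a time: [integral_comp_weight] extends the formula from
    an indicator to any function in one factor, the other factors being the weight. *)
Lemma integral_prod_independent (h : I -> V -> R) : mutually_independent Z ->
  (forall i, measurable_fun setT (h i)) -> (forall i x, (0 <= h i x)%R) ->
  (forall i, \int[P]_w (h i (Z i w))%:E < +oo) ->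
  \int[P]_w (\prod_i h i (Z i w))%:E = \prod_i \int[P]_w (h i (Z i w))%:E.
Proof.
move=> indep mh h0 hfin.
have : forall i, i \notin enum I ->
    exists2 B : set V, measurable B & h i = \1_B.
  by move=> i; rewrite mem_enum.
elim: (enum I) h mh h0 hfin => [h mh h0 hfin hind|i s IH h mh h0 hfin hind].
  have /choice[B hB] : forall i, exists B : set V, measurable B /\ h i = \1_B.
    by move=> i; have [B mB hB] := hind i isT; exists B.
  under eq_integral do under eq_bigr do rewrite (hB _).2.
  rewrite integral_prod_indic//; last by move=> i; have [] := hB i.
  by apply: eq_bigr => i _; rewrite (hB i).2.
pose G w := (\prod_(j | j != i) h j (Z j w))%R.
have mG : measurable_fun setT G.
  rewrite /G; under eq_fun do rewrite -big_filter.
  by apply: measurable_prod => j _; exact: measurableT_comp.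
have G0 w : (0 <= G w)%R by rewrite prodr_ge0.
have fin_h j : \int[P]_w (h j (Z j w))%:E \is a fin_num.
  rewrite ge0_fin_numE//; apply: integral_ge0 => w _; by rewrite lee_fin.
under eq_integral do rewrite (bigD1 i)//=.
rewrite [RHS](bigD1 i)//=.
apply: (@integral_comp_weight _ _ _ _ _ P (Z i) G _ _ mG G0) => //.
- apply: (big_ind (fun x : \bar R => x \is a fin_num)) => // x y.
  exact: fin_numM.
- move=> B mB; pose h' j := if j == i then \1_B else h j.
  have h'i : h' i = \1_B by rewrite /h' eqxx.
  have h'N j : j != i -> h' j = h j by rewrite /h'; case: eqVneq.
  transitivity (\int[P]_w (\prod_j h' j (Z j w))%:E).
    apply: eq_integral => w _; rewrite (bigD1 i)//= h'i; congr (_ * _)%:E.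
    by apply: eq_bigr => j ji; rewrite h'N.
  rewrite IH.
  - rewrite (bigD1 i)//= h'i; congr (_ * _).
    by apply: eq_bigr => j ji; rewrite h'N.
  - by move=> j; rewrite /h'; case: eqP.
  - by move=> j x; rewrite /h'; case: eqP.
  - move=> j; have [->|ji] := eqVneq j i; last by rewrite h'N.
    rewrite h'i; have mZB : measurable (Z i @^-1` B) by exact: measurable_funPTI.
    rewrite (_ : (fun w => _) = EFin \o \1_(Z i @^-1` B))//.
    by rewrite integral_indic// setIT (le_lt_trans (probability_le1 _ _))// ltry.
  - move=> j js; have [->|ji] := eqVneq j i; first by exists B.
    by rewrite h'N//; apply: hind; rewrite inE negb_or ji.
Qed.

End IndependentProduct.

(** * Expectations of real functions *)

Section RealExpectation.
Context d (T : measurableType d) (R : realType) (P : probability T R).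
Implicit Types (f g : T -> R) (c : R).

Definition has_mean (f : T -> R) : Prop := P.-integrable setT (EFin \o f).

Lemma rexpE f : rexpectation P f = fine (\int[P]_w (f w)%:E)%E.
Proof. by rewrite /rexpectation unlock. Qed.

Lemma EFin_rexp f : has_mean f -> (rexpectation P f)%:E = (\int[P]_w (f w)%:E)%E.
Proof. by move=> intf; rewrite rexpE fineK//; exact: integrable_fin_num. Qed.

Lemma has_mean_measurable f : has_mean f -> measurable_fun setT f.
Proof. by move=> /measurable_int /measurable_EFinP. Qed.

Lemma ge0_has_mean f : measurable_fun setT f -> (forall w, 0 <= f w) ->
  (\int[P]_w (f w)%:E < +oo)%E -> has_mean f.
Proof.
move=> mf f0 fin; apply/integrableP; split; first exact/measurable_EFinP.
rewrite (eq_integral (fun w => (f w)%:E))// => w _.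
by rewrite /= ger0_norm.
Qed.

Lemma le_has_mean f g : measurable_fun setT f -> has_mean g ->
  (forall w, `|f w| <= g w) -> has_mean f.
Proof.
move=> mf intg fg; apply: (le_integrable measurableT _ _ intg).
- exact/measurable_EFinP.
- by move=> w _ /=; rewrite lee_fin (le_trans (fg w))// ler_norm.
Qed.

Lemma has_mean_cst c : has_mean (fun=> c).
Proof. by apply: finite_measure_integrable_cst. Qed.

Lemma has_meanD f g : has_mean f -> has_mean g -> has_mean (fun w => f w + g w).
Proof. by move=> If Ig; have := integrableD measurableT If Ig. Qed.

Lemma has_meanZ c f : has_mean f -> has_mean (fun w => c * f w).
Proof. by move=> If; have := integrableZl measurableT c If. Qed.

Lemma has_mean_sum (I : Type) (s : seq I) (F : I -> T -> R) :
  (forall i, has_mean (F i)) -> has_mean (fun w => \sum_(i <- s) F i w).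
Proof.
move=> IF; elim: s => [|i s IH].
  by under eq_fun do rewrite big_nil; exact: has_mean_cst.
by under eq_fun do rewrite big_cons; exact: has_meanD.
Qed.

Lemma rexp_cst c : rexpectation P (fun=> c) = c.
Proof. by rewrite rexpE integral_cst//= probability_setT mule1. Qed.

Lemma rexpD f g : has_mean f -> has_mean g ->
  rexpectation P (fun w => f w + g w) = rexpectation P f + rexpectation P g.
Proof. by move=> If Ig; rewrite !rexpE; exact: (RintegralD measurableT If Ig). Qed.

Lemma rexpZ c f : has_mean f ->
  rexpectation P (fun w => c * f w) = c * rexpectation P f.
Proof. by move=> If; rewrite !rexpE; exact: (RintegralZl c measurableT If). Qed.

Lemma rexp_sum (I : Type) (s : seq I) (F : I -> T -> R) :
  (forall i, has_mean (F i)) ->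
  rexpectation P (fun w => \sum_(i <- s) F i w) =
  \sum_(i <- s) rexpectation P (F i).
Proof.
move=> IF; elim: s => [|i s IH].
  by under eq_fun do rewrite big_nil; rewrite big_nil rexp_cst.
under eq_fun do rewrite big_cons; rewrite big_cons rexpD ?IH//.
exact: has_mean_sum.
Qed.

Lemma rexp_ge0 f : (forall w, 0 <= f w) -> 0 <= rexpectation P f.
Proof.
by move=> f0; rewrite rexpE fine_ge0// integral_ge0// => w _; rewrite lee_fin.
Qed.

Lemma ler_rexp f g : has_mean f -> has_mean g -> (forall w, f w <= g w) ->
  rexpectation P f <= rexpectation P g.
Proof.
move=> If Ig fg; rewrite -lee_fin !EFin_rexp//; apply: le_integral => // w _.
by rewrite lee_fin.
Qed.

Lemma ae_eq_rexp f g : measurable_fun setT f -> measurable_fun setT g ->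
  {ae P, forall w, f w = g w} -> rexpectation P f = rexpectation P g.
Proof.
move=> mf mg fg; rewrite !rexpE; congr fine; apply: ae_eq_integral => //.
- exact/measurable_EFinP.
- exact/measurable_EFinP.
- by apply: filterS fg => w -> _.
Qed.

Lemma rexp_eq0_ae f : has_mean f -> (forall w, 0 <= f w) ->
  rexpectation P f = 0 -> {ae P, forall w, f w = 0}.
Proof.
move=> If f0 Ef0.
have : (\int[P]_w `|(f w)%:E| = 0)%E.
  rewrite -[RHS]/(0%R%:E) -Ef0 EFin_rexp//.
  by apply: eq_integral => w _; rewrite gee0_abs// lee_fin.
move/(ae_eq_integral_abs P measurableT (measurable_int _ If)).
by apply: filterS => w /= /(_ Logic.I) [].
Qed.

Lemma markov_rexp f (c : R) : has_mean f -> (forall w, 0 <= f w) -> 0 < c ->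
  (P [set w | (c <= f w)%R] <= (rexpectation P f / c)%:E)%E.
Proof.
move=> If f0 c0; have mf := has_mean_measurable If.
have mA : measurable [set w | c <= f w].
  rewrite -[X in measurable X]setTI; apply: measurable_fun_ler => //.
rewrite EFinM lee_pdivlMr//= muleC EFin_rexp//.
rewrite -[X in P X]setIT -integral_indic// -ge0_integralZl//; last 2 first.
- exact/measurable_EFinP.
- by rewrite lee_fin ltW.
apply: ge0_le_integral => //=.
- by move=> w _; rewrite mule_ge0// lee_fin ltW.
- by apply: measurable_funeM; apply/measurable_EFinP.
- exact/measurable_EFinP.
- move=> w _; rewrite -EFinM lee_fin indicE; case: (boolP (w \in _)) => [|_].
    by rewrite inE /= mulr1.
  by rewrite mulr0.
Qed.

End RealExpectation.

(** * Tail bounds for independent copies *)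

Section IndependentCopies.
Context d d' (T : measurableType d) (V : measurableType d') (R : realType)
  (P : probability T R) (n : nat) (Zs : 'I_n -> {RV P >-> V})
  (Z : {RV P >-> V}).
Hypothesis copies : independent_copies Zs Z.
Implicit Types (f g : V -> R).

Lemma copies_integral f i : measurable_fun setT f -> (forall v, 0 <= f v) ->
  (\int[P]_w (f (Zs i w))%:E = \int[P]_w (f (Z w))%:E)%E.
Proof.
move=> mf f0.
have mfE : measurable_fun setT (EFin \o f) by exact/measurable_EFinP.
have f0E v : (0 <= (EFin \o f) v)%E by rewrite lee_fin.
rewrite -[LHS](ge0_integral_distribution (Zs i) mfE f0E).
rewrite -[RHS](ge0_integral_distribution Z mfE f0E).
by apply: eq_measure_integral => A mA _; exact: copies.2.
Qed.

Lemma copies_rexp f i : measurable_fun setT f -> (forall v, 0 <= f v) ->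
  rexpectation P (fun w => f (Zs i w)) = rexpectation P (fun w => f (Z w)).
Proof. by move=> mf f0; rewrite !rexpE copies_integral. Qed.

Lemma copies_has_mean f i : measurable_fun setT f -> (forall v, 0 <= f v) ->
  has_mean P (fun w => f (Z w)) -> has_mean P (fun w => f (Zs i w)).
Proof.
move=> mf f0 If; apply: ge0_has_mean => //; first exact: measurableT_comp.
rewrite copies_integral// -EFin_rexp//; exact: ltry.
Qed.

Lemma copies_ae (A : set V) i : measurable A ->
  {ae P, forall w, A (Z w)} -> {ae P, forall w, A (Zs i w)}.
Proof.
move=> mA; have mZA (X : {RV P >-> V}) : measurable (~` (X @^-1` A)).
  by apply: measurableC; exact: measurable_funPTI.
move=> /(negligibleP P (mZA Z)) A0.
apply/(negligibleP P (mZA (Zs i))); apply: etrans A0.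
exact: (copies.2 i _ (measurableC mA)).
Qed.

(** The polynomial [1 + f + f^2 / 2] replaces the exponential of the usual Chernoff
    argument: its expectation involves only the first two moments, so that no
    exponential moment of [f] is needed. *)
Lemma chernoff_quadratic f (s L : R) : measurable_fun setT f ->
  has_mean P (fun w => f (Z w)) -> has_mean P (fun w => f (Z w) ^+ 2) ->
  rexpectation P (fun w => f (Z w)) = 0 ->
  rexpectation P (fun w => f (Z w) ^+ 2) <= s ->
  (P [set w | (expR (n%:R * (s / 2) + L) <=
      \prod_i (1 + f (Zs i w) + f (Zs i w) ^+ 2 / 2))%R] <= (expR (- L))%:E)%E.
Proof.
move=> mf If If2 Ef0 Ef2.
pose F v := 1 + f v + f v ^+ 2 / 2.
have mF : measurable_fun setT F.
  by apply: measurable_funD; [exact: measurable_funD|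
    apply: measurable_funM => //; exact: measurable_funX].
have F0 v : 0 <= F v by rewrite /F; nra.
have IFf2 : has_mean P (fun w => f (Z w) ^+ 2 / 2).
  by under eq_fun do rewrite mulrC; exact: has_meanZ.
have IF : has_mean P (fun w => F (Z w)).
  by apply: has_meanD => //; apply: has_meanD => //; exact: has_mean_cst.
have EF : rexpectation P (fun w => F (Z w)) <= 1 + s / 2.
  rewrite /F rexpD//; last by apply: has_meanD => //; exact: has_mean_cst.
  rewrite rexpD//; last exact: has_mean_cst.
  rewrite rexp_cst Ef0 addr0.
  under [in X in rexpectation _ X]eq_fun do rewrite mulrC.
  by rewrite rexpZ// mulrC; lra.
have EF0 : 0 <= rexpectation P (fun w => F (Z w)) by exact: rexp_ge0.
have prodE : (\int[P]_w (\prod_i F (Zs i w))%:E)%E =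
    (rexpectation P (fun w => F (Z w)) ^+ n)%:E.
  rewrite (integral_prod_independent (h := fun _ => F))//; last 2 first.
  - exact: copies.1.
  - by move=> i; rewrite copies_integral// -EFin_rexp// ltry.
  under eq_bigr do rewrite copies_integral// -EFin_rexp//.
  by rewrite prodEFin prodr_const card_ord.
have mprod : measurable_fun setT (fun w => \prod_i F (Zs i w)).
  by apply: measurable_prod => i _; exact: measurableT_comp.
have Iprod : has_mean P (fun w => \prod_i F (Zs i w)).
  apply: ge0_has_mean => //; last by rewrite prodE ltry.
  by move=> w; exact: prodr_ge0.
apply: (le_trans (markov_rexp Iprod _ _)).
- by move=> w; exact: prodr_ge0.
- exact: expR_gt0.
rewrite rexpE prodE/= lee_fin ler_pdivrMr ?expR_gt0// -expRD.
rewrite (_ : - L + _ = n%:R * (s / 2)); last by ring.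
rewrite expRM_natl lerXn2r ?nnegrE ?expR_ge0//.
exact: (le_trans EF (expR_ge1Dx _)).
Qed.

(** Chebyshev's inequality for the sum. Only the uncentred second moment enters,
    because the variance of the sum is at most [n E g^2]. *)
Lemma chebyshev_sum g (eps : R) : measurable_fun setT g -> (forall v, 0 <= g v) ->
  has_mean P (fun w => g (Z w)) -> has_mean P (fun w => g (Z w) ^+ 2) ->
  0 < rexpectation P (fun w => g (Z w) ^+ 2) -> 0 < eps -> (0 < n)%N ->
  (P [set w | (n%:R * (rexpectation P (fun w => g (Z w)) +
      Num.sqrt (rexpectation P (fun w => g (Z w) ^+ 2) / (n%:R * eps)))
      <= \sum_i g (Zs i w))%R] <= eps%:E)%E.
Proof.
move=> mg g0 Ig Ig2 Eg2 eps0 n0.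
set m := rexpectation P (fun w => g (Z w)).
set m2 := rexpectation P (fun w => g (Z w) ^+ 2) in Eg2 *.
have n0R : 0 < n%:R :> R by rewrite ltr0n.
have mgs i : measurable_fun setT (fun w => g (Zs i w)) by exact: measurableT_comp.
have Igs i : has_mean P (fun w => g (Zs i w)) by exact: copies_has_mean.
have mg2 : measurable_fun setT (fun v => g v ^+ 2) by exact: measurable_funX.
have Ig2s i : has_mean P (fun w => g (Zs i w) ^+ 2).
  by apply: (copies_has_mean i mg2) => // v; exact: sqr_ge0.
have Igg i j : has_mean P (fun w => g (Zs i w) * g (Zs j w)).
  apply: (le_has_mean _ (has_meanD (Ig2s i) (Ig2s j))).
    exact: measurable_funM.
  move=> w; rewrite ger0_norm ?mulr_ge0//.
  by have := g0 (Zs i w); have := g0 (Zs j w); nra.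
have sum_ord_cst (c : R) : \sum_(i < n) c = n%:R * c.
  by rewrite sumr_const card_ord mulr_natl.
have Egg i j : i != j ->
    rexpectation P (fun w => g (Zs i w) * g (Zs j w)) = m ^+ 2.
  move=> ij; pose h l := if (l == i) || (l == j) then g else fun=> 1.
  have hE : (fun w => g (Zs i w) * g (Zs j w)) = (fun w => \prod_l h l (Zs l w)).
    apply/funext => w; rewrite (bigD1 i)//= (bigD1 j) 1?eq_sym//= big1.
      by rewrite /h !eqxx orbT/= mulr1.
    by move=> l /andP[/negPf li /negPf lj]; rewrite /h li lj.
  have h1 l : h l = g \/ h l = fun=> 1 by rewrite /h; case: ifP; [left|right].
  have mh l : measurable_fun setT (h l) by case: (h1 l) => ->.
  have h0 l v : 0 <= h l v by case: (h1 l) => ->.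
  have Ih l : has_mean P (fun w => h l (Z w)).
    by case: (h1 l) => -> //; exact: has_mean_cst.
  rewrite hE rexpE (integral_prod_independent copies.1)//; last first.
    by move=> l; rewrite copies_integral// -EFin_rexp// ltry.
  under eq_bigr do rewrite copies_integral// -EFin_rexp//.
  rewrite prodEFin /= (bigD1 i)//= (bigD1 j) 1?eq_sym//= big1.
    by rewrite /h !eqxx orbT/= mulr1.
  by move=> l /andP[/negPf li /negPf lj]; rewrite /h li lj rexp_cst.
pose D w := (\sum_i g (Zs i w) - n%:R * m) ^+ 2.
have DE : D = (fun w => (\sum_i \sum_j g (Zs i w) * g (Zs j w) +
    (- (2 * n%:R * m)) * \sum_i g (Zs i w)) + (n%:R * m) ^+ 2).
  apply/funext => w; rewrite /D sqrrB expr2 mulr_suml.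
  under eq_bigr do rewrite mulr_sumr.
  by ring.
have Isum1 := has_mean_sum (index_enum 'I_n) Igs.
have Isum2 : has_mean P (fun w => \sum_i \sum_j g (Zs i w) * g (Zs j w)).
  by apply: has_mean_sum => i; exact: has_mean_sum.
have ID12 := has_meanD Isum2 (has_meanZ (- (2 * n%:R * m)) Isum1).
have ID : has_mean P D.
  by rewrite DE; apply: has_meanD => //; exact: has_mean_cst.
have ED : rexpectation P D <= n%:R * m2.
  rewrite DE rexpD//; last exact: has_mean_cst.
  rewrite rexp_cst rexpD//; last exact: has_meanZ.
  rewrite rexpZ// !rexp_sum//; last by move=> i; exact: has_mean_sum.
  rewrite (eq_bigr (fun=> m2 + (n%:R - 1) * m ^+ 2)) => [|i _]; last first.
    rewrite rexp_sum// (bigD1 i)//= (eq_bigr (fun=> m ^+ 2)) => [|j ji]; last first.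
      by rewrite Egg// eq_sym.
    congr (_ + _); first by apply: (copies_rexp i mg2) => v; exact: sqr_ge0.
    by rewrite sumr_const cardC1 card_ord -[LHS]mulr_natl -subn1 natrB.
  rewrite (eq_bigr (fun=> m) (fun i _ => copies_rexp i mg g0)).
  rewrite !sum_ord_cst.
  have : 0 <= n%:R * m ^+ 2 by rewrite mulr_ge0 ?sqr_ge0// ltW.
  rewrite (_ : n%:R * (m2 + _) + _ + _ = n%:R * m2 - n%:R * m ^+ 2); first by lra.
  by ring.
pose t := n%:R * Num.sqrt (m2 / (n%:R * eps)).
have t2 : t ^+ 2 = n%:R * m2 / eps.
  rewrite exprMn sqr_sqrtr; last by rewrite divr_ge0 ?mulr_ge0// ltW.
  by field; rewrite !gt_eqF.
have t0 : 0 <= t by rewrite mulr_ge0 ?sqrtr_ge0// ltW.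
have t20 : 0 < t ^+ 2 by rewrite t2 divr_gt0// mulr_gt0.
apply: (@le_trans _ _ (P [set w | (t ^+ 2 <= D w)%R])).
  have mD := has_mean_measurable ID.
  have msum : measurable_fun setT (fun w => \sum_i g (Zs i w)).
    exact: has_mean_measurable Isum1.
  apply: le_measure; rewrite ?inE.
  - rewrite -[X in measurable X]setTI; apply: measurable_fun_le => //.
  - rewrite -[X in measurable X]setTI; apply: measurable_fun_le => //.
  - move=> w /=; rewrite mulrDr -/t => tS.
    by rewrite /D lerXn2r ?nnegrE//; lra.
apply: (le_trans (markov_rexp ID _ t20)); first by move=> w; exact: sqr_ge0.
rewrite lee_fin ler_pdivrMr// t2 [leRHS](_ : _ = n%:R * m2)//.
by field; rewrite gt_eqF.
Qed.

End IndependentCopies.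

(** * A polynomial upper bound of the exponential *)

Section ExponentialInequality.
Context (R : realType).
Implicit Types (t q : R).

Let A (a b t : R) : R := (1 + t + t ^+ 2 / 2) * expR (- t + a * t ^+ 2 + b * t ^+ 3).

(** Each bound [exp (t - a t^2 - b t^3) <= 1 + t + t^2 / 2] says [1 <= A a b t], and
    follows from the sign of the derivative of [A a b]. *)
Let dA a b t : is_derive t 1 (A a b)
  (expR (- t + a * t ^+ 2 + b * t ^+ 3) *
   ((1 + t) + (1 + t + t ^+ 2 / 2) * (- 1 + 2 * a * t + 3 * b * t ^+ 2))).
Proof.
apply: is_derive_eq.
by rewrite /GRing.scale/=; field.
Qed.

Let cA a b (i : interval R) : {within [set` i], continuous (A a b)}.
Proof.
apply: derivable_within_continuous => t _; exact: (@ex_derive _ _ _ _ _ _ _ (dA a b t)).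
Qed.

Let A'E a b t : (A a b)^`()%classic t = expR (- t + a * t ^+ 2 + b * t ^+ 3) *
   ((1 + t) + (1 + t + t ^+ 2 / 2) * (- 1 + 2 * a * t + 3 * b * t ^+ 2)).
Proof. by rewrite derive1E (@derive_val _ _ _ _ _ _ _ (dA a b t)). Qed.

Let A_ge1 a b t : 1 <= A a b t -> expR (t - (a * t ^+ 2 + b * t ^+ 3)) <= 1 + t + t ^+ 2 / 2.
Proof.
move=> A1; rewrite -[leLHS]mul1r -ler_pdivlMr ?expR_gt0// -expRN.
by rewrite (_ : - _ = - t + a * t ^+ 2 + b * t ^+ 3)//; ring.
Qed.

Lemma expR_le_quadratic_neg t : t <= 0 -> expR t <= 1 + t + t ^+ 2 / 2.
Proof.
move=> t0; rewrite -[X in expR X]subr0 -[X in t - X](_ : 0 * t ^+ 2 + 0 * t ^+ 3 = 0).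
  apply: A_ge1; rewrite [leLHS](_ : 1 = A 0 0 0); last first.
    by rewrite /A !(expr0n, mulr0, mul0r, addr0, oppr0) expR0 mulr1.
  apply: (@ler0_derive1_nincr _ (A 0 0) t 0) => // x.
  rewrite in_itv/= => /andP[tx x0]; rewrite A'E.
  by rewrite pmulr_rle0 ?expR_gt0//; nra.
by ring.
Qed.

Lemma expR_le_quadratic_cubic t : 0 <= t ->
  expR (t - t ^+ 3 / 6) <= 1 + t + t ^+ 2 / 2.
Proof.
move=> t0; rewrite (_ : t ^+ 3 / 6 = 0 * t ^+ 2 + 6^-1 * t ^+ 3); last by ring.
apply: A_ge1; rewrite [leLHS](_ : 1 = A 0 6^-1 0); last first.
  by rewrite /A !(expr0n, mulr0, mul0r, addr0, oppr0) expR0 mulr1.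
apply: (@ger0_derive1_ndecr _ (A 0 6^-1) 0 t) => // x.
rewrite in_itv/= => /andP[x0 xt]; rewrite A'E mulr_ge0 ?expR_ge0//.
have -> : 1 + x + (1 + x + x ^+ 2 / 2) * (-1 + 2 * 0 * x + 3 * 6^-1 * x ^+ 2) =
    x ^+ 3 / 2 + x ^+ 4 / 4 by field.
  by rewrite addr_ge0// divr_ge0// exprn_ge0// ltW.
Qed.

Lemma expR_le_quadratic_square t : 1 <= t ->
  expR (t - t ^+ 2 / 6) <= 1 + t + t ^+ 2 / 2.
Proof.
move=> t1; rewrite (_ : t ^+ 2 / 6 = 6^-1 * t ^+ 2 + 0 * t ^+ 3); last by ring.
apply: A_ge1; apply: (@le_trans _ _ (A 6^-1 0 1)).
  rewrite /A; apply: le_trans (ler_wpM2r (expR_ge0 _) (expR_le_quadratic_cubic ler01)).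
  by rewrite -expRD -[leLHS]expR0 ler_expR !expr1n; lra.
apply: (@ger0_derive1_ndecr _ (A 6^-1 0) 1 t) => // x.
rewrite in_itv/= => /andP[x0 xt]; rewrite A'E mulr_ge0 ?expR_ge0//.
  by nra.
Qed.

(** Below 1 the power [t^q] dominates the cube and above 1 it dominates the square,
    because [2 <= q <= 3]; and [1 / 6 <= 1 / (2 q)]. The factor 2 in [2 q] is what
    leaves room for the discretization of the ball later. *)
Lemma expR_le_quadratic_powR t q : 2 <= q <= 3 ->
  expR (t - (Num.max t 0) `^ q / (2 * q)) <= 1 + t + t ^+ 2 / 2.
Proof.
move=> /andP[q2 q3]; have q0 : 0 < q by lra.
have [t0|t0] := leP t 0.
  by rewrite powR0 ?gt_eqF// mul0r subr0; exact: expR_le_quadratic_neg.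
have le6 x : 0 <= x -> x / 6 <= x / (2 * q).
  by move=> x0; rewrite ler_wpM2l// lef_pV2 ?posrE; lra.
have [t1|t1] := leP t 1.
  apply: le_trans (expR_le_quadratic_cubic (ltW t0)).
  rewrite ler_expR lerB//; apply: le_trans (le6 _ (powR_ge0 _ _)).
  rewrite ler_pM2r//; rewrite -(powR_mulrn _ (ltW t0)).
  by rewrite ger_powR// t0.
apply: le_trans (expR_le_quadratic_square (ltW t1)).
rewrite ler_expR lerB//; apply: le_trans (le6 _ (powR_ge0 _ _)).
rewrite ler_pM2r//; rewrite -(powR_mulrn _ (ltW t0)).
by rewrite ler_powR// ltW.
Qed.

End ExponentialInequality.

(** * Nets of the Euclidean ball *)

Section Euclidean.
Context (R : realType) (D : nat).
Implicit Types (u v : 'cV[R]_D) (a : R).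

Lemma dotE u v : dot u v = \sum_j u j 0 * v j 0.
Proof. by rewrite /dot mxE; apply: eq_bigr => j _; rewrite mxE. Qed.

Lemma dotC u v : dot u v = dot v u.
Proof. by rewrite !dotE; apply: eq_bigr => j _; rewrite mulrC. Qed.

Lemma dotDl u1 u2 v : dot (u1 + u2) v = dot u1 v + dot u2 v.
Proof. by rewrite /dot linearD mulmxDl mxE. Qed.

Lemma dotDr v u1 u2 : dot v (u1 + u2) = dot v u1 + dot v u2.
Proof. by rewrite dotC dotDl !(dotC v). Qed.

Lemma dotZl a u v : dot (a *: u) v = a * dot u v.
Proof. by rewrite /dot linearZ -scalemxAl mxE. Qed.

Lemma dotZr a u v : dot u (a *: v) = a * dot u v.
Proof. by rewrite dotC dotZl dotC. Qed.

Lemma dotNl u v : dot (- u) v = - dot u v.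
Proof. by rewrite -scaleN1r dotZl mulN1r. Qed.

Lemma dotNr u v : dot u (- v) = - dot u v.
Proof. by rewrite dotC dotNl dotC. Qed.

Lemma dot0l v : dot 0 v = 0.
Proof. by rewrite -(scale0r (0 : 'cV_D)) dotZl mul0r. Qed.

Lemma dotBl u1 u2 v : dot (u1 - u2) v = dot u1 v - dot u2 v.
Proof. by rewrite dotDl dotNl. Qed.

Lemma dotBr v u1 u2 : dot v (u1 - u2) = dot v u1 - dot v u2.
Proof. by rewrite dotDr dotNr. Qed.

Lemma dot_mulmx u v (M : 'M[R]_D) : dot u (M *m v) = dot (M^T *m u) v.
Proof. by rewrite /dot trmx_mul trmxK mulmxA. Qed.

Lemma dot_sqr_ge0 u : 0 <= dot u u.
Proof. by rewrite dotE sumr_ge0// => j _; rewrite -expr2 sqr_ge0. Qed.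

Lemma dot_eq0 u : (dot u u == 0) = (u == 0).
Proof.
apply/eqP/eqP => [|->]; last exact: dot0l.
rewrite dotE => /eqP; rewrite psumr_eq0 => [/allP u0|j _]; last first.
  by rewrite -expr2 sqr_ge0.
apply/colP => j; rewrite mxE.
by have := u0 j (mem_index_enum _); rewrite -expr2 sqrf_eq0 => /eqP.
Qed.

Lemma cauchy_schwarz u v : dot u v ^+ 2 <= dot u u * dot v v.
Proof.
have [/eqP|v0] := eqVneq (dot v v) 0.
  by rewrite dot_eq0 => /eqP ->; rewrite dotC !dot0l expr0n mulr0.
have vv : 0 < dot v v by rewrite lt0r v0 dot_sqr_ge0.
have := dot_sqr_ge0 (dot v v *: u - dot u v *: v).
rewrite !(dotBl, dotBr, dotZl, dotZr) (dotC v u).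
rewrite (_ : _ - _ = dot v v * (dot u u * dot v v - dot u v ^+ 2)); last by ring.
by rewrite pmulr_rge0// subr_ge0.
Qed.

Lemma ler_entry_sqr u j : u j 0 ^+ 2 <= dot u u.
Proof.
rewrite dotE (bigD1 j)//= -expr2 lerDl sumr_ge0// => i _.
by rewrite -expr2 sqr_ge0.
Qed.

End Euclidean.

Section Net.
Context (R : realType) (D k : nat).
Hypotheses (D0 : (0 < D)%N) (k0 : (0 < k)%N).

(** Points of the grid of step [1 / (k sqrt D)], coded by a sign and a magnitude in
    each coordinate. By the Cauchy-Schwarz inequality the magnitudes of a point of
    the unit ball add up to at most [k D]. *)
Let code := {ffun 'I_D -> bool * 'I_(k * D).+1}.
Let weight (f : code) : nat := \sum_j (f j).2.
Let point (f : code) : 'cV[R]_D :=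
  \col_j ((-1) ^+ (f j).1 * (f j).2%:R / (k%:R * Num.sqrt D%:R)).

(** Exponential counting: the sum of [2^(- weight)] over all codes factorizes over the
    coordinates, each factor being at most [2 (1 + 1/2 + 1/4 + ...) = 4]. *)
Lemma card_light_codes :
  (#|[set f : code | (weight f <= k * D)%N]%SET| <= 2 ^ ((k + 2) * D))%N.
Proof.
rewrite -(ler_nat R) natrX.
have sum_digit : \sum_(z : bool * 'I_(k * D).+1) (2^-1 : R) ^+ z.2 <= 2 ^+ 2.
  rewrite (eq_bigr (fun z : bool * 'I_(k * D).+1 => (2^-1 : R) ^+ z.2))//.
  rewrite -(pair_bigA _ (fun (b : bool) (z : 'I_(k * D).+1) => (2^-1 : R) ^+ z))/=.
  have half_step (r : R) : 2 - r + 2^-1 * r <= 2 - 2^-1 * r by lra.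
  have geo (N : nat) : \sum_(z < N.+1) (2^-1 : R) ^+ z <= 2 - 2^-1 ^+ N.
    elim: N => [|N IH]; first by rewrite big_ord1 !expr0; lra.
    have e := exprS (2^-1 : R) N.
    rewrite big_ord_recr/= e; apply: (le_trans (lerD IH (lexx _))).
    exact: half_step.
  have geo2 : \sum_(z < (k * D).+1) (2^-1 : R) ^+ z <= 2.
    by rewrite (le_trans (geo _))// gerBl exprn_ge0.
  by rewrite big_bool expr2 mulr2n mulrDl mul1r lerD.
have total : \sum_(f : code) (2^-1 : R) ^+ weight f <= 2 ^+ (2 * D).
  rewrite (eq_bigr (fun f : code => \prod_j (2^-1 : R) ^+ (f j).2)); last first.
    by move=> f _; rewrite /weight prodrXr.
  rewrite -(bigA_distr_bigA (fun (_ : 'I_D) (z : bool * 'I_(k * D).+1) =>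
    (2^-1 : R) ^+ z.2))/=.
  rewrite prodr_const card_ord exprM lerXn2r// nnegrE ?exprn_ge0//.
  by apply: sumr_ge0 => z _; rewrite exprn_ge0.
rewrite -sum1_card natr_sum/=.
apply: (@le_trans _ _ (\sum_(f : code) 2 ^+ (k * D) * (2^-1 : R) ^+ weight f)).
  rewrite big_mkcond/=; apply: ler_sum => f _.
  have [fw|_] := ifP; last by rewrite mulr_ge0 ?exprn_ge0.
  move: fw; rewrite inE => fw; rewrite exprVn ler_pdivlMr ?exprn_gt0// mul1r.
  by rewrite ler_eXn2l ?ltr1n.
rewrite -mulr_sumr mulnDl exprD ler_wpM2l ?exprn_ge0//.
Qed.

(** Rounding the coordinates towards zero keeps the point in the unit ball and moves
    it by at most [sqrt D] times the step. *)
Lemma exists_net : exists (N : nat) (x : 'I_N -> 'cV[R]_D),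
  [/\ (N <= 2 ^ ((k + 2) * D))%N, forall i, dot (x i) (x i) <= 1 &
    forall u : 'cV[R]_D, dot u u <= 1 ->
      exists i, dot (u - x i) (u - x i) <= (k%:R ^+ 2)^-1].
Proof.
pose net := [set f : code | (weight f <= k * D)%N & dot (point f) (point f) <= 1]%SET.
exists #|net|, (fun i => point (enum_val i)); split.
- apply: leq_trans card_light_codes; apply: subset_leq_card.
  by apply/fintype.subsetP => f; rewrite !inE => /andP[].
- by move=> i; have := enum_valP i; rewrite inE => /andP[].
move=> u u1.
have sD : 0 < Num.sqrt D%:R :> R by rewrite sqrtr_gt0 ltr0n.
have sD2 : Num.sqrt D%:R ^+ 2 = D%:R :> R by rewrite sqr_sqrtr.
have kR : 0 < k%:R :> R by rewrite ltr0n.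
pose h : R := k%:R * Num.sqrt D%:R.
have h0 : 0 < h by rewrite mulr_gt0.
pose m j := Num.truncn (`|u j 0| * h).
have mle j : (m j)%:R <= `|u j 0| * h by rewrite truncn_le// mulr_ge0// ltW.
have ltm j : `|u j 0| * h < (m j)%:R + 1.
  by rewrite natr1 truncnS_gt.
have sum_abs : (\sum_j `|u j 0|) ^+ 2 <= D%:R.
  pose s : 'cV[R]_D := \col_j `|u j 0|; pose e : 'cV[R]_D := \col_j 1.
  have := cauchy_schwarz s e.
  rewrite !dotE (eq_bigr (fun j => `|u j 0|)); last by move=> j _; rewrite !mxE mulr1.
  rewrite [X in _ <= _ * X](eq_bigr (fun=> 1)); last by move=> j _; rewrite !mxE mulr1.
  rewrite [X in _ <= X * _](eq_bigr (fun j => u j 0 * u j 0)); last first.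
    by move=> j _; rewrite !mxE -normrM ger0_norm// -expr2 sqr_ge0.
  rewrite -dotE sumr_const card_ord => /le_trans; apply.
  by rewrite ler_piMl.
have sum_m : (\sum_j m j <= k * D)%N.
  rewrite -(ler_nat R) natr_sum (le_trans (ler_sum _ (fun j _ => mle j)))//.
  have abs_le : \sum_j `|u j 0| <= Num.sqrt D%:R.
    by rewrite -(@ler_pXn2r _ 2)// ?sD2// nnegrE ?sqrtr_ge0// sumr_ge0.
  rewrite -mulr_suml (le_trans (ler_wpM2r (ltW h0) abs_le))//.
  by rewrite /h natrM mulrCA -expr2 sD2.
have m_small j : (m j < (k * D).+1)%N.
  by rewrite ltnS (leq_trans _ sum_m)// (bigD1 j)//= leq_addr.
pose f : code := [ffun j => (u j 0 < 0, Ordinal (m_small j))].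
have pointE j : point f j 0 = (-1) ^+ (u j 0 < 0)%R * ((m j)%:R / h).
  by rewrite !mxE ffunE/= mulrA.
have near j : (u j 0 - point f j 0) ^+ 2 <= h^-1 ^+ 2.
  have uE := realEsign (num_real (u j 0)).
  rewrite pointE {1}uE -mulrBr exprMn.
  rewrite -signr_odd sqrr_sign mul1r lerXn2r ?nnegrE//.
  - by rewrite subr_ge0 ler_pdivrMr.
  - by rewrite invr_ge0 ltW.
  have : `|u j 0| < ((m j)%:R + 1) / h by rewrite ltr_pdivlMr.
  by rewrite lerBlDr mulrDl mul1r addrC => /ltW.
have below j : point f j 0 ^+ 2 <= u j 0 ^+ 2.
  rewrite pointE exprMn -signr_odd sqrr_sign mul1r -[leRHS]real_normK ?num_real//.
  by rewrite lerXn2r// ?ler_pdivrMr// nnegrE divr_ge0// ltW.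
have fnet : f \in net.
  rewrite inE; apply/andP; split.
    by rewrite /weight; under eq_bigr do rewrite ffunE/=.
  apply: le_trans u1; rewrite !dotE; apply: ler_sum => j _.
  by rewrite -!expr2.
exists (enum_rank_in fnet f); rewrite enum_rankK_in// dotE.
apply: (@le_trans _ _ (\sum_(j < D) h^-1 ^+ 2)).
  apply: ler_sum => j _; rewrite -expr2.
  by have := near j; rewrite !mxE.
rewrite sumr_const card_ord -[leLHS]mulr_natr exprVn /h exprMn sD2 invfM.
by rewrite mulfVK// pnatr_eq0 -lt0n.
Qed.

End Net.

Section NetQuadraticForm.
Context (R : realType) (D k N : nat) (x : 'I_N -> 'cV[R]_D) (M : 'M[R]_D) (m : R).
Hypotheses (k2 : (2 < k)%N) (symM : M^T = M).
Hypotheses (x1 : forall i, dot (x i) (x i) <= 1)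
  (netx : forall u : 'cV[R]_D, dot u u <= 1 ->
    exists i, dot (u - x i) (u - x i) <= (k%:R ^+ 2)^-1)
  (Mx : forall i, `|dot (x i) (M *m x i)| <= m).

Let Q (u : 'cV[R]_D) := dot u (M *m u).

Let bounded_by (C : R) := 0 <= C /\ forall u, `|Q u| <= C * dot u u.

Let dotM_sym u v : dot u (M *m v) = dot v (M *m u).
Proof. by rewrite dot_mulmx symM dotC. Qed.

Let QZ a u : Q (a *: u) = a ^+ 2 * Q u.
Proof. by rewrite /Q -scalemxAr dotZl dotZr mulrA expr2. Qed.

Let polar u v : dot u (M *m v) = (Q (u + v) - Q (u - v)) / 4.
Proof.
rewrite /Q mulmxDr mulmxBr !(dotDl, dotDr, dotBl, dotBr, dotNl, dotNr).
by rewrite (dotM_sym v u); field.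
Qed.

Let bounded_some : bounded_by (\sum_i \sum_j `|M i j|).
Proof.
split=> [|u]; first by rewrite sumr_ge0// => i _; rewrite sumr_ge0.
rewrite /Q dotE (eq_bigr (fun i => \sum_j u i 0 * (M i j * u j 0))) => [|i _]; last first.
  by rewrite mxE mulr_sumr.
apply: (le_trans (ler_norm_sum _ _ _)).
rewrite mulr_suml; apply: ler_sum => i _.
apply: (le_trans (ler_norm_sum _ _ _)).
rewrite mulr_suml; apply: ler_sum => j _.
rewrite !normrM mulrCA ler_wpM2l//.
have := ler_entry_sqr u i; have := ler_entry_sqr u j.
rewrite -(real_normK (num_real (u i 0))) -(real_normK (num_real (u j 0))).
by have := sqr_ge0 (`|u i 0| - `|u j 0|); nra.
Qed.

(** Moving from a point of the ball to the net costs [(v - x) M (v + x)], where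
    [|v - x| <= 1 / k] and [|v + x| <= 2]; polarization bounds it by [2 C / k]. *)
Let contraction C : bounded_by C -> bounded_by (m + 2 / k%:R * C).
Proof.
move=> [C0 QC].
have kR : 0 < k%:R :> R by rewrite ltr0n (ltn_trans _ k2).
have m0 : 0 <= m.
  have [|i _] := netx (u := 0); first by rewrite dot0l.
  exact: le_trans (Mx i).
split=> [|u]; first by rewrite addr_ge0// mulr_ge0// divr_ge0// ltW.
have unit_ball v : dot v v <= 1 -> `|Q v| <= m + 2 / k%:R * C.
  move=> v1; have [i vi] := netx v1.
  (* The factor 2 k gives both arguments of the bilinear form norm at most 2,
     which balances the two squares produced by polarization. *)
  have QE : Q v = Q (x i) + (2 * k%:R)^-1 * dot ((2 * k%:R) *: (v - x i)) (M *m (v + x i)).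
    rewrite dotZl mulrA mulVf ?mul1r; last by rewrite mulf_neq0 ?gt_eqF.
    by rewrite /Q mulmxDr !(dotBl, dotDr) (dotM_sym (x i) v); ring.
  rewrite QE (le_trans (ler_normD _ _))// lerD//; first exact: Mx.
  rewrite normrM ger0_norm ?invr_ge0; last by rewrite mulr_ge0 ?ltW.
  rewrite mulrC ler_pdivrMr ?mulr_gt0// polar.
  set a := (2 * k%:R) *: (v - x i); set b := v + x i.
  have aa : dot a a <= 4.
    rewrite /a dotZl dotZr -[leRHS](_ : (2 * k%:R) * ((2 * k%:R) * (k%:R ^+ 2)^-1) = 4).
      by rewrite !ler_pM2l ?mulr_gt0.
    by field; rewrite gt_eqF.
  have bb : dot b b <= 4.
    have := dot_sqr_ge0 (v - x i); have := x1 i; move: v1.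
    rewrite /b !(dotDl, dotDr, dotBl, dotBr, dotNl, dotNr) (dotC (x i) v).
    by lra.
  clearbody a b; have := QC (a + b); have := QC (a - b).
  have -> : dot (a - b) (a - b) = dot a a + dot b b - 2 * dot a b.
    by rewrite !(dotBl, dotBr) (dotC b a); ring.
  have -> : dot (a + b) (a + b) = dot a a + dot b b + 2 * dot a b.
    by rewrite !(dotDl, dotDr) (dotC b a); ring.
  rewrite !ler_norml => /andP[h1 h2] /andP[h3 h4].
  have -> : 2 / k%:R * C * (2 * k%:R) = 4 * C by field; rewrite gt_eqF.
  have h5 : C * dot a a <= C * 4 by rewrite ler_wpM2l.
  have h6 : C * dot b b <= C * 4 by rewrite ler_wpM2l.
  by apply/andP; split; lra.
have [/eqP|u0] := eqVneq (dot u u) 0.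
  by rewrite dot_eq0 => /eqP ->; rewrite /Q !dot0l normr0 mulr0.
have uu : 0 < dot u u by rewrite lt0r u0 dot_sqr_ge0.
pose r := Num.sqrt (dot u u).
have r0 : 0 < r by rewrite sqrtr_gt0.
have r2 : r ^+ 2 = dot u u by rewrite sqr_sqrtr ?ltW.
pose u' := r^-1 *: u.
have u'1 : dot u' u' = 1 by rewrite dotZl dotZr -r2; field; rewrite gt_eqF.
have -> : u = r *: u' by rewrite scalerA divff ?scale1r ?gt_eqF.
rewrite QZ normrM ger0_norm ?sqr_ge0// dotZl dotZr u'1 mulr1 -expr2 mulrC.
by rewrite ler_wpM2r ?sqr_ge0// unit_ball// u'1.
Qed.

(** The best constant [C] satisfies [C <= m + 2 C / k] by [contraction]. *)
Lemma net_quadratic_form u : `|Q u| <= m / (1 - 2 / k%:R) * dot u u.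
Proof.
pose E : set R := [set C | bounded_by C].
have E0 : E !=set0 by exists (\sum_i \sum_j `|M i j|); exact: bounded_some.
have lbE : has_lbound E by exists 0 => C [].
have kR : 0 < k%:R :> R by rewrite ltr0n (ltn_trans _ k2).
have k2R : 2 / k%:R < 1 :> R by rewrite ltr_pdivrMr// mul1r ltr_nat.
have bounded_inf : bounded_by (inf E).
  split=> [|v]; first by apply: lb_le_inf => // C [].
  have [/eqP|v0] := eqVneq (dot v v) 0.
    by rewrite dot_eq0 => /eqP ->; rewrite /Q !dot0l normr0 mulr0.
  have vv : 0 < dot v v by rewrite lt0r v0 dot_sqr_ge0.
  rewrite -ler_pdivrMr//; apply: lb_le_inf => // C [_ QC].
  by rewrite ler_pdivrMr.
have inf_le : inf E <= m + 2 / k%:R * inf E.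
  by apply: ge_inf => //; exact: contraction.
apply: (le_trans (bounded_inf.2 u)); rewrite ler_wpM2r ?dot_sqr_ge0//.
by rewrite ler_pdivlMr ?subr_gt0//; lra.
Qed.

End NetQuadraticForm.

(** * Uniform deviation of an empirical Gram matrix *)

Lemma union_bound d (T : measurableType d) (R : realType) (P : probability T R)
    (I : Type) (s : seq I) (A : I -> set T) (c : R) :
  (forall i, measurable (A i)) -> (forall i, (P (A i) <= c%:E)%E) ->
  (P (\big[setU/set0]_(i <- s) A i) <= ((size s)%:R * c)%:E)%E.
Proof.
move=> mA PA; elim: s => [|i s IH]; first by rewrite big_nil measure0 mul0r.
rewrite big_cons /= -natr1 mulrDl mul1r addrC EFinD.
apply: (le_trans (measureU2 _ _ _)) => //; first exact: bigsetU_measurable.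
by rewrite leeD// PA.
Qed.

Section GramDeviation.
Context d d' (T : measurableType d) (V : measurableType d') (R : realType)
  (P : probability T R) (n D : nat) (Zs : 'I_n -> {RV P >-> V})
  (Z : {RV P >-> V}) (W : V -> 'cV[R]_D).
Variables (q kappa lam : R).
Hypotheses (copies : independent_copies Zs Z) (n0 : (0 < n)%N)
  (D0 : (0 < D)%N) (mW : forall j, measurable_fun setT (fun v => W v j 0))
  (q23 : 2 <= q <= 3) (kappa_ge1 : 1 <= kappa) (lam0 : 0 < lam).

Let sqn v : R := dot (W v) (W v).
Let g v : R := sqn v `^ q.
Let x u v : R := dot u (W v) ^+ 2.
Let a u : R := rexpectation P (fun w => x u (Z w)).

Hypothesis (Ig2 : has_mean P (fun w => g (Z w) ^+ 2)).
Hypothesis (a_le : forall u, a u <= dot u u).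
Hypothesis (fourth_le : forall u,
  rexpectation P (fun w => dot u (W (Z w)) ^+ 4) <= kappa * a u ^+ 2).

Let nR : 0 < n%:R :> R. Proof. by rewrite ltr0n. Qed.
Let q0 : 0 < q. Proof. by move: q23 => /andP[]; lra. Qed.

Let mdot u : measurable_fun setT (fun v => dot u (W v)).
Proof.
under eq_fun do rewrite dotE.
by apply: measurable_sum => j; exact: measurable_funM.
Qed.

Let mx u : measurable_fun setT (x u). Proof. exact: measurable_funX. Qed.

Let msqn : measurable_fun setT sqn.
Proof.
rewrite /sqn; under eq_fun do rewrite dotE.
by apply: measurable_sum => j; exact: measurable_funM.
Qed.

Let mg : measurable_fun setT g.
Proof. exact: (measurableT_comp (measurable_powR q)). Qed.

Let sqn0 v : 0 <= sqn v. Proof. exact: dot_sqr_ge0. Qed.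
Let g0 v : 0 <= g v. Proof. exact: powR_ge0. Qed.

Let sqn2_le v : sqn v ^+ 2 <= 1 + g v ^+ 2.
Proof.
have [y1|y1] := leP (sqn v) 1.
  have : sqn v ^+ 2 <= 1 by rewrite expr_le1.
  by have := sqr_ge0 (g v); lra.
have : sqn v ^+ 2 <= g v ^+ 2.
  by rewrite lerXn2r ?nnegrE// le1r_powR// ?ltW//; move: q23 => /andP[]; lra.
by lra.
Qed.

Let Ig : has_mean P (fun w => g (Z w)).
Proof.
apply: (le_has_mean _ (has_meanD (has_mean_cst P 1) Ig2)).
  exact: measurableT_comp.
by move=> w; rewrite ger0_norm//; have := g0 (Z w); nra.
Qed.

Let Isqn2 : has_mean P (fun w => sqn (Z w) ^+ 2).
Proof.
apply: (le_has_mean _ (has_meanD (has_mean_cst P 1) Ig2)).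
  by apply: measurable_funX; exact: measurableT_comp.
by move=> w; rewrite ger0_norm ?sqr_ge0.
Qed.

Let x0 u v : 0 <= x u v. Proof. exact: sqr_ge0. Qed.

Let x_le u v : x u v <= dot u u * sqn v.
Proof. exact: cauchy_schwarz. Qed.

Let Ix2 u : has_mean P (fun w => x u (Z w) ^+ 2).
Proof.
apply: (le_has_mean _ (has_meanZ (dot u u ^+ 2) Isqn2)).
  by apply: measurable_funX; exact: measurableT_comp.
move=> w; rewrite ger0_norm ?sqr_ge0// -exprMn lerXn2r ?nnegrE ?sqr_ge0//.
by rewrite mulr_ge0// dot_sqr_ge0.
Qed.

Let Ix u : has_mean P (fun w => x u (Z w)).
Proof.
apply: (le_has_mean _ (has_meanD (has_mean_cst P 1) (Ix2 u))).
  exact: measurableT_comp.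
by move=> w; rewrite ger0_norm ?sqr_ge0//; nra.
Qed.

Let a0 u : 0 <= a u. Proof. by apply: rexp_ge0 => w; exact: sqr_ge0. Qed.

Let t u (s : bool) v : R := (-1) ^+ s * lam * (x u v - a u).

Let mt u s : measurable_fun setT (t u s).
Proof. by apply: measurable_funM => //; exact: measurable_funB. Qed.

(** Outside this event the empirical mean of [x u] cannot deviate much upwards
    ([s = false]), respectively downwards ([s = true]). *)
Let bad u L (s : bool) : set T :=
  [set w | (expR (n%:R * (lam ^+ 2 * (kappa - 1) / 2) + L) <=
      \prod_i (1 + t u s (Zs i w) + t u s (Zs i w) ^+ 2 / 2))%R].

Let mbad u L s : measurable (bad u L s).
Proof.
rewrite -[X in measurable X]setTI; apply: measurable_fun_le => //.
apply: measurable_prod => i _; apply: measurable_funD.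
  by apply: measurable_funD => //; exact: measurableT_comp.
by apply: measurable_funM => //; apply: measurable_funX; exact: measurableT_comp.
Qed.

Let Pbad u L s : dot u u <= 1 -> (P (bad u L s) <= (expR (- L))%:E)%E.
Proof.
move=> u1; have a1 : a u <= 1 by exact: le_trans (a_le u) u1.
have Iconst c := has_mean_cst P c.
have It : has_mean P (fun w => t u s (Z w)).
  by apply: has_meanZ; exact: has_meanD.
have t2E : (fun w => t u s (Z w) ^+ 2) = (fun w => lam ^+ 2 * x u (Z w) ^+ 2 +
    ((- (2 * lam ^+ 2 * a u)) * x u (Z w) + lam ^+ 2 * a u ^+ 2)).
  apply/funext => w; rewrite /t; move: (x u (Z w)) => y.
  by rewrite !exprMn sqrr_sign; ring.
have I1 := has_meanZ (lam ^+ 2) (Ix2 u).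
have I2 := has_meanZ (- (2 * lam ^+ 2 * a u)) (Ix u).
have I3 := has_meanD I2 (Iconst (lam ^+ 2 * a u ^+ 2)).
apply: (chernoff_quadratic copies _ (mt u s) It) => //.
- by rewrite t2E; exact: has_meanD.
- rewrite /t rexpZ ?rexpD//; last exact: has_meanD.
  by rewrite rexp_cst subrr mulr0.
- rewrite t2E rexpD// rexpD// rexp_cst !rexpZ// -/(a u).
  have := fourth_le u; rewrite (_ : (fun w => _) = (fun w => x u (Z w) ^+ 2)); last first.
    by apply/funext => w; rewrite /x -exprM.
  set m2 := rexpectation P _ => m2le.
  rewrite (_ : _ + _ = lam ^+ 2 * (m2 - a u ^+ 2)); last by ring.
  rewrite ler_wpM2l ?sqr_ge0//.
  apply: (@le_trans _ _ ((kappa - 1) * a u ^+ 2)); first by lra.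
  by rewrite ler_piMr ?subr_ge0// expr_le1.
Qed.

(** The truncation cost is [t_+^q / (2 q)]. Upwards [t_+ <= lam |W|^2]; downwards
    [t_+ <= lam], whose power is absorbed by the moment bound since [1 <= B]. *)
Let off_bad u L s (B : R) w : dot u u <= 1 -> 1 <= B ->
  \sum_i g (Zs i w) <= n%:R * B -> ~ bad u L s w ->
  (-1) ^+ s * (n%:R^-1 * \sum_i x u (Zs i w) - a u) <=
  lam * (kappa - 1) / 2 + L / (n%:R * lam) + lam `^ (q - 1) / (2 * q) * B.
Proof.
move=> u1 B1 gB /negP; rewrite -real_ltNge ?num_real// => bad_lt.
have a1 : a u <= 1 by exact: le_trans (a_le u) u1.
pose c v := Num.max (t u s v) 0 `^ q / (2 * q).
have tc : \sum_i (t u s (Zs i w) - c (Zs i w)) <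
    n%:R * (lam ^+ 2 * (kappa - 1) / 2) + L.
  rewrite -ltr_expR expR_sum; apply: le_lt_trans bad_lt.
  by apply: ler_prod => i _; rewrite expR_ge0/= expR_le_quadratic_powR.
have c_sum : \sum_i c (Zs i w) <= lam `^ q / (2 * q) * (n%:R * B).
  have q20 : 0 <= (2 * q)^-1 by rewrite invr_ge0 mulr_ge0// ltW.
  have lq0 := powR_ge0 lam q.
  rewrite /c -mulr_suml mulrAC ler_wpM2r//.
  case: s {bad_lt tc} @c => /=.
  - apply: (@le_trans _ _ (\sum_(i < n) lam `^ q)).
      apply: ler_sum => i _; apply: ge0_ler_powR;
        [exact: ltW|by rewrite nnegrE le_max lexx orbT|by rewrite nnegrE ltW|].
      rewrite ge_max (ltW lam0) andbT /t expr1 mulN1r mulNr -mulrN opprB.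
      rewrite ler_piMr ?(ltW lam0)//; have := x0 u (Zs i w); lra.
    rewrite sumr_const card_ord -[leLHS]mulr_natr ler_wpM2l//.
    by rewrite ler_peMr// ltW.
  - apply: (@le_trans _ _ (\sum_(i < n) lam `^ q * g (Zs i w))).
      apply: ler_sum => i _; rewrite /g -powRM ?(ltW lam0)//.
      apply: ge0_ler_powR; [exact: ltW|by rewrite nnegrE le_max lexx orbT|
        by rewrite nnegrE mulr_ge0// ltW|].
      rewrite ge_max mulr_ge0 ?(ltW lam0)// andbT /t expr0 mul1r ler_wpM2l ?(ltW lam0)//.
      have := x_le u (Zs i w); have := a0 u.
      have : dot u u * sqn (Zs i w) <= sqn (Zs i w) by rewrite ler_piMl.
      by lra.
    by rewrite -mulr_sumr ler_wpM2l.
rewrite sumrB in tc.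
have tE : \sum_i t u s (Zs i w) =
    n%:R * lam * ((-1) ^+ s * (n%:R^-1 * \sum_i x u (Zs i w) - a u)).
  rewrite /t -mulr_sumr sumrB sumr_const card_ord -mulr_natl.
  by field; rewrite gt_eqF.
rewrite -(ler_pM2l (mulr_gt0 nR lam0)) -tE.
have lamq : lam * lam `^ (q - 1) = lam `^ q by rewrite mulr_powRB1// ltW.
rewrite -lamq in c_sum.
rewrite (_ : n%:R * lam * _ = n%:R * (lam ^+ 2 * (kappa - 1) / 2) + L +
    lam * lam `^ (q - 1) / (2 * q) * (n%:R * B)); last first.
  by field; rewrite !gt_eqF.
by lra.
Qed.

Let gram_matrix w : 'M[R]_D := \matrix_(j, l)
  (n%:R^-1 * \sum_i W (Zs i w) j 0 * W (Zs i w) l 0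
   - rexpectation P (fun w => W (Z w) j 0 * W (Z w) l 0)).

Let mean_entry j l : has_mean P (fun w => W (Z w) j 0 * W (Z w) l 0).
Proof.
apply: (le_has_mean _ (has_meanD (has_mean_cst P 1) Isqn2)).
  by apply: measurable_funM; apply: (measurableT_comp (mW _)).
move=> w; have := ler_entry_sqr (W (Z w)) j; have := ler_entry_sqr (W (Z w)) l.
rewrite -/(sqn _) normrM => h1 h2.
rewrite -(real_normK (num_real (W _ l 0))) in h1.
rewrite -(real_normK (num_real (W _ j 0))) in h2.
have := sqr_ge0 (`|W (Z w) j 0| - `|W (Z w) l 0|).
have := sqr_ge0 (sqn (Z w) - 1); have := sqn0 (Z w); nra.
Qed.

Let gram_form u w : dot u (gram_matrix w *m u) =
  n%:R^-1 * \sum_i x u (Zs i w) - a u.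
Proof.
have xE v : x u v = \sum_j \sum_l (u j 0 * u l 0) * (W v j 0 * W v l 0).
  rewrite /x expr2 dotE mulr_suml; apply: eq_bigr => j _.
  by rewrite mulr_sumr; apply: eq_bigr => l _; ring.
have Iterm j l : has_mean P (fun w => (u j 0 * u l 0) * (W (Z w) j 0 * W (Z w) l 0)).
  exact: has_meanZ.
have -> : a u = \sum_j \sum_l (u j 0 * u l 0) *
    rexpectation P (fun w => W (Z w) j 0 * W (Z w) l 0).
  rewrite /a; under [in X in rexpectation _ X]eq_fun do rewrite xE.
  rewrite rexp_sum; last by move=> j; exact: has_mean_sum.
  apply: eq_bigr => j _; rewrite rexp_sum//; apply: eq_bigr => l _.
  by rewrite rexpZ.
under [in RHS]eq_bigr do rewrite xE.
rewrite exchange_big/= mulr_sumr -sumrB dotE; apply: eq_bigr => j _.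
rewrite exchange_big/= mulr_sumr -sumrB mxE mulr_sumr; apply: eq_bigr => l _.
by rewrite mxE -mulr_sumr; ring.
Qed.

(** The hypothesis on [L] makes the union bound over the net cost [eps] for each of
    the two tails. The last [eps] is the probability that the empirical moment of
    order [q] exceeds [B], an event common to all directions. *)
Lemma gram_deviation (k : nat) (eps L : R) : (2 < k)%N -> 0 < eps ->
  2 ^+ ((k + 2) * D) <= eps * expR L ->
  let B := rexpectation P (fun w => g (Z w)) +
    Num.sqrt (rexpectation P (fun w => g (Z w) ^+ 2) / (n%:R * eps)) in
  1 <= B -> 0 < rexpectation P (fun w => g (Z w) ^+ 2) ->
  with_probability_at_least P (1 - 3 * eps) [set w | forall u : 'cV[R]_D,
    `|n%:R^-1 * \sum_i dot u (W (Zs i w)) ^+ 2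
      - rexpectation P (fun w => dot u (W (Z w)) ^+ 2)| <=
    (lam * (kappa - 1) / 2 + L / (n%:R * lam) + lam `^ (q - 1) / (2 * q) * B)
      / (1 - 2 / k%:R) * dot u u].
Proof.
move=> k2 eps0 netL B B1 Eg2.
have [N [xs [Nle xs1 xsnet]]] := @exists_net R D k D0 (ltn_trans (ltn0Sn _) k2).
pose tail : set T := [set w | (n%:R * B <= \sum_i g (Zs i w))%R].
have mtail : measurable tail.
  rewrite -[X in measurable X]setTI; apply: measurable_fun_le => //.
  by apply: measurable_sum => i; exact: measurableT_comp.
have Ptail : (P tail <= eps%:E)%E by exact: chebyshev_sum.
pose badU s := \big[setU/set0]_(i < N) bad (xs i) L s.
have mbadU s : measurable (badU s) by exact: bigsetU_measurable.
have PbadU s : (P (badU s) <= eps%:E)%E.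
  apply: (le_trans (@union_bound _ _ _ _ _ _ _ (expR (- L)) _ _)) => [i|i|].
  - exact: mbad.
  - exact: Pbad.
  rewrite lee_fin expRN ler_pdivrMr ?expR_gt0//; apply: le_trans netL.
  have -> : size (index_enum 'I_N) = N.
    by rewrite -sum1_size sum1_card card_ord.
  by rewrite -natrX ler_nat.
pose A := ~` (tail `|` (badU false `|` badU true)).
have mtb : measurable (tail `|` (badU false `|` badU true)).
  by do 2 apply: measurableU => //.
exists A; split; first exact: measurableC.
- move=> w Aw u /=.
  have tailw : \sum_i g (Zs i w) <= n%:R * B.
    by rewrite leNgt; apply/negP => /ltW tw; apply: Aw; left.
  have badw i s : ~ bad (xs i) L s w.
    move=> bw; apply: Aw; right; case: s bw => bw; [right|left];
      by rewrite /badU -bigcup_seq; exists i => //=; rewrite mem_index_enum.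
  rewrite -gram_form; apply: (net_quadratic_form k2 _ xs1 xsnet) => [|i].
    apply/matrixP => j l; rewrite !mxE; congr (_ * _ - _).
      by apply: eq_bigr => i _; rewrite mulrC.
    by under eq_fun do rewrite mulrC.
  rewrite gram_form; have h1 := off_bad (xs1 i) B1 tailw (badw i false).
  have h2 := off_bad (xs1 i) B1 tailw (badw i true).
  by rewrite expr0 mul1r in h1; rewrite expr1 mulN1r lerNl in h2;
    rewrite ler_norml h1 h2.
rewrite probability_setC// EFinB leeB//.
apply: (le_trans (measureU2 _ _ _)) => //; first exact: measurableU.
rewrite (_ : 3 * eps = eps + (eps + eps)); last by ring.
rewrite !EFinD leeD//; apply: (le_trans (measureU2 _ _ _)) => //.
by rewrite leeD ?PbadU.
Qed.

End GramDeviation.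

(** * Comparison of the net bound with mu *)

Section Constants.
Context (R : realType).

Lemma two_le_expR45 : (2 : R) <= expR (4 / 5).
Proof.
rewrite expRM_natl.
apply: (@le_trans _ _ ((1 + 5^-1) ^+ 4)); first by lra.
by rewrite lerXn2r ?nnegrE ?expR_ge0 ?expR_ge1Dx//; lra.
Qed.

Lemma net_cardinal_le (k D : nat) (eps : R) : 0 < eps ->
  2 ^+ ((k + 2) * D) <= eps * expR (ln eps^-1 + 4 / 5 * ((k + 2) * D)%:R).
Proof.
move=> eps0; rewrite expRD lnK ?posrE ?invr_gt0// mulrA divff ?gt_eqF// mul1r.
by rewrite expRM_natr lerXn2r ?nnegrE ?expR_ge0// two_le_expR45.
Qed.

(** [z] stands for [sqrt (L / D)]. A fixed scale serves while [z] is moderate; for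
    large [z] the loss [2 / k] must be of order [1 / z], hence [k] close to [z]. *)
Lemma exists_net_scale (z : R) : 0 <= z -> 73 / 100 <= z ^+ 2 ->
  exists2 k : nat, (4 <= k)%N & 2 * z ^+ 2 +
    k%:R * (2 / 5 * k%:R + 87 / 200) <= 681 / 100 * (k%:R - 2) * z.
Proof.
move=> z0 z2; have zlo : 85 / 100 <= z.
  by rewrite -(@ler_pXn2r _ 2)// ?nnegrE; lra.
have [z6|z6] := leP z 6. 
  exists 4%N => //.
  have : 0 <= (z - 85 / 100) * (6 - z) by rewrite mulr_ge0//; lra.
  rewrite expr2; have := zlo; lra.
have tz : (Num.truncn z)%:R <= z by rewrite truncn_le.
have zt := truncnS_gt z.
exists (Num.truncn z); first by rewrite truncn_ge_nat//; lra.
rewrite -natr1 in zt; move: ((Num.truncn z)%:R : R) tz zt => k tz zt.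
have : 0 <= z * (441 / 100 * k - 1606 / 100).
  by apply: mulr_ge0; [exact: z0|lra].
have : k * k <= z * k by rewrite ler_wpM2r//; lra.
have : z * z <= z * (k + 1) by rewrite ler_wpM2l// ltW.
by rewrite expr2; lra.
Qed.

Lemma net_scale_ratio (z k : R) : 0 < z -> 4 <= k ->
  2 * z ^+ 2 + k * (2 / 5 * k + 87 / 200) <= 681 / 100 * (k - 2) * z ->
  1 + (2 / 5 * k + 87 / 200) / z ^+ 2 <= (1 + 681 / 100 / z) * (1 - 2 / k).
Proof.
move=> z0 k4 h; have k0 : 0 < k by lra.
rewrite -subr_ge0.
have -> : (1 + 681 / 100 / z) * (1 - 2 / k) - (1 + (2 / 5 * k + 87 / 200) / z ^+ 2) =
  (681 / 100 * (k - 2) * z - (2 * z ^+ 2 + k * (2 / 5 * k + 87 / 200))) / (k * z ^+ 2).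
  by field; rewrite !gt_eqF.
by apply: divr_ge0; [lra|apply: mulr_ge0; [exact: ltW|exact: sqr_ge0]].
Qed.

(** Let [s = sqrt (2 (K - 1) L / n)] be the first term of [mu]. The choice of [lam]
    gives [lam (K - 1) = s] and [n lam = 2 L / s], so the left-hand side is [s] times
    a factor depending on [k] and [z] only, while [s / z] is at most
    [sqrt K * sqrt (2 D / n)], the unit of the second term of [mu]. *)
Lemma deviation_le_mu (K D n l : R) : 1 < K -> 1 <= D -> 0 < n -> 0 < l ->
  let L := l + 73 / 100 * D in
  let lam := Num.sqrt (2 * L / ((K - 1) * n)) in
  exists2 k : nat, (4 <= k)%N &
    (lam * (K - 1) / 2 + (l + 4 / 5 * ((k%:R + 2) * D)) / (n * lam))
      / (1 - 2 / k%:R) <=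
    Num.sqrt (2 * (K - 1) / n * L) +
      681 / 100 * Num.sqrt K * Num.sqrt (2 * D / n).
Proof.
move=> K1 D1 n0 l0 L lam.
have K10 : 0 < K - 1 by lra.
have D0 : 0 < D by lra.
have L0 : 0 < L by rewrite /L; lra.
pose z := Num.sqrt (L / D).
have z2 : z ^+ 2 = L / D by rewrite sqr_sqrtr// divr_ge0// ltW.
have z0 : 0 < z by rewrite sqrtr_gt0 divr_gt0.
have [|k k4 kz] := exists_net_scale (ltW z0).
  by rewrite z2 ler_pdivlMr// /L; lra.
exists k => //; have k4R : 4 <= k%:R :> R by rewrite ler_nat.
pose s := Num.sqrt (2 * (K - 1) / n * L); rewrite -/s.
have s2 : s ^+ 2 = 2 * (K - 1) / n * L.
  by rewrite sqr_sqrtr// mulr_ge0 ?divr_ge0 ?mulr_ge0// ltW.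
have s0 : 0 < s by rewrite sqrtr_gt0 mulr_gt0 ?divr_gt0 ?mulr_gt0.
have lamE : lam = s / (K - 1).
  apply/eqP; rewrite -(@eqrXn2 _ 2)// ?sqrtr_ge0 ?divr_ge0 ?ltW//.
  rewrite expr_div_n s2 sqr_sqrtr ?divr_ge0 ?mulr_ge0 ?ltW//.
  by apply/eqP; field; rewrite !gt_eqF.
have LE : L = z ^+ 2 * D by rewrite z2; field; rewrite gt_eqF.
have nE : n = 2 * (K - 1) * L / s ^+ 2.
  by rewrite s2; field; rewrite !gt_eqF.
have devE : lam * (K - 1) / 2 + (l + 4 / 5 * ((k%:R + 2) * D)) / (n * lam) =
    s * (1 + (2 / 5 * k%:R + 87 / 200) / z ^+ 2).
  have -> : l + 4 / 5 * ((k%:R + 2) * D) = L + (4 / 5 * k%:R + 87 / 100) * D.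
    by rewrite /L; lra.
  by rewrite lamE nE LE; field; rewrite !gt_eqF.
have szE : s / z <= Num.sqrt K * Num.sqrt (2 * D / n).
  have Dn0 : 0 <= 2 * D / n by rewrite divr_ge0 ?mulr_ge0// ltW.
  have K0 : 0 <= K by lra.
  have e1 : (s / z) ^+ 2 = (K - 1) * (2 * D / n).
    by rewrite expr_div_n s2 z2; field; rewrite !gt_eqF.
  have e2 : (Num.sqrt K * Num.sqrt (2 * D / n)) ^+ 2 = K * (2 * D / n).
    by rewrite exprMn (sqr_sqrtr K0) (sqr_sqrtr Dn0).
  have sz0 : 0 <= s / z by rewrite divr_ge0// ltW.
  rewrite -(@ler_pXn2r _ 2) ?e1 ?e2// ?nnegrE ?mulr_ge0 ?sqrtr_ge0//.
  by rewrite ler_wpM2r// lerBlDr lerDl.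
rewrite devE.
have k2R : 0 < 1 - 2 / k%:R :> R by rewrite subr_gt0 ltr_pdivrMr; lra.
apply: (@le_trans _ _ (s * (1 + 681 / 100 / z))).
  rewrite -mulrA ler_wpM2l ?(ltW s0)// ler_pdivrMr//.
  exact: net_scale_ratio.
rewrite mulrDr mulr1 lerD2l -[681 / 100 * _ * _]mulrA.
have -> : s * (681 / 100 / z) = 681 / 100 * (s / z) by ring.
by apply: ler_wpM2l; [lra|exact: szE].
Qed.

(** With [b = sqrt (2 (K - 1) L)] the hypothesis is
    [20 k sqrt D + (5 / 2 + 1 / (2 (K - 1))) b < sqrt n] and the conclusion is
    [13.62 sqrt 2 k sqrt D + 2 b < sqrt n]. *)
Lemma mu_lt_half (k D n K L : R) : 1 < K -> 0 <= k -> 0 <= D -> 0 < n -> 0 <= L ->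
  (20 * k * Num.sqrt D + (5 / 2 + 1 / (2 * (K - 1))) * Num.sqrt (2 * (K - 1) * L)) ^+ 2
    < n ->
  2 * (Num.sqrt (2 * (K - 1) / n * L) + 681 / 100 * k * Num.sqrt (2 * D / n)) < 1.
Proof.
move=> K1 k0 D0 n0 L0 hn.
pose b := Num.sqrt (2 * (K - 1) * L); pose c := Num.sqrt D.
have sn0 : 0 < Num.sqrt n by rewrite sqrtr_gt0.
have -> : Num.sqrt (2 * (K - 1) / n * L) = b / Num.sqrt n.
  by rewrite mulrAC sqrtrM ?sqrtrV// ?mulr_ge0//; lra.
have -> : Num.sqrt (2 * D / n) = Num.sqrt 2 * c / Num.sqrt n.
  by rewrite sqrtrM ?mulr_ge0// sqrtrV ?ltW// sqrtrM.
have sqrt2 : Num.sqrt 2 <= 146 / 100 :> R.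
  by rewrite -(@ler_pXn2r _ 2)// ?nnegrE ?sqrtr_ge0// ?sqr_sqrtr//; lra.
have b0 : 0 <= b by rewrite sqrtr_ge0.
have c0 : 0 <= c by rewrite sqrtr_ge0.
have kc0 : 0 <= k * c by rewrite mulr_ge0.
have hK : 0 <= 1 / (2 * (K - 1)) by rewrite divr_ge0//; lra.
have : 20 * k * c + (5 / 2 + 1 / (2 * (K - 1))) * b < Num.sqrt n.
  rewrite -(@ltr_pXn2r _ 2)// ?nnegrE ?sqr_sqrtr ?(ltW n0)// ?sqrtr_ge0//.
  by rewrite addr_ge0 ?mulr_ge0// addr_ge0//; lra.
have -> : 2 * (b / Num.sqrt n + 681 / 100 * k * (Num.sqrt 2 * c / Num.sqrt n)) =
    (2 * b + 1362 / 100 * (k * (Num.sqrt 2 * c))) / Num.sqrt n.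
  by field; rewrite gt_eqF.
move=> h; rewrite ltr_pdivrMr// mul1r; apply: le_lt_trans h.
have : k * (Num.sqrt 2 * c) <= 146 / 100 * (k * c).
  by rewrite mulrCA ler_wpM2r.
have : 0 <= 1 / (2 * (K - 1)) * b by rewrite mulr_ge0.
by lra.
Qed.

End Constants.

(** * Moments of sums *)

Section PowerMoments.
Context d (T : measurableType d) (R : realType) (P : probability T R).
Implicit Types (f g : T -> R).

Lemma rexp_minkowski f g (s : R) : 1 <= s ->
  measurable_fun setT f -> measurable_fun setT g ->
  (forall w, 0 <= f w) -> (forall w, 0 <= g w) ->
  has_mean P (fun w => f w `^ s) -> has_mean P (fun w => g w `^ s) ->
  has_mean P (fun w => (f w + g w) `^ s) /\
  rexpectation P (fun w => (f w + g w) `^ s) <=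
    (rexpectation P (fun w => f w `^ s) `^ s^-1 +
     rexpectation P (fun w => g w `^ s) `^ s^-1) `^ s.
Proof.
move=> s1 mf mg f0 g0 If Ig; have s0 : 0 < s by lra.
have norm_int (h : T -> R) : (forall w, 0 <= h w) ->
    (\int[P]_w (`|(EFin \o h) w| `^ s) = \int[P]_w (h w `^ s)%:E)%E.
  by move=> h0; apply: eq_integral => w _; rewrite /= ger0_norm.
have LnormE (h : T -> R) : (forall w, 0 <= h w) -> has_mean P (fun w => h w `^ s) ->
    ('N[P]_s%:E[EFin \o h] = (rexpectation P (fun w => h w `^ s) `^ s^-1)%:E)%E.
  by move=> h0 Ih; rewrite unlock norm_int// -EFin_rexp// poweR_EFin.
have fg0 w : 0 <= f w + g w by rewrite addr_ge0.
have mfg : measurable_fun setT (fun w => (f w + g w) `^ s).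
  by apply: (measurableT_comp (measurable_powR s)); exact: measurable_funD.
set b := _ + _; have b0 : 0 <= b by rewrite addr_ge0// powR_ge0.
have int_le : (\int[P]_w ((f w + g w) `^ s)%:E <= (b `^ s)%:E)%E.
  rewrite -(norm_int (f \+ g)%R)// -poweR_Lnorm ?gt_eqF// -poweR_EFin.
  apply: gt0_ler_poweR => //; first exact: ltW.
  - by rewrite in_itv/= leey andbT Lnorm_ge0.
  - by rewrite in_itv/= leey andbT lee_fin.
  - by have := minkowski_EFin P mf mg s1; rewrite (LnormE f)// (LnormE g)// -EFinD.
have Ifg : has_mean P (fun w => (f w + g w) `^ s).
  apply: ge0_has_mean => //; first by move=> w; exact: powR_ge0.
  exact: le_lt_trans int_le (ltry _).
by split=> //; rewrite -lee_fin EFin_rexp.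
Qed.

(** Jensen's inequality through its tangent line at 1, [s y <= y^s + (s - 1)], which
    is Young's inequality for [y * 1]. *)
Lemma rexp_powR_ge1 f (s : R) : 1 < s -> (forall w, 0 <= f w) ->
  has_mean P f -> has_mean P (fun w => f w `^ s) ->
  rexpectation P f = 1 -> 1 <= rexpectation P (fun w => f w `^ s).
Proof.
move=> s1 f0 If Ifs Ef1; have s0 : 0 < s by lra.
have young w : s * f w <= f w `^ s + (s - 1).
  have := @conjugate_powR R (f w) 1 s (s / (s - 1)) (f0 w) ler01 s0.
  rewrite powR1 mulr1 invf_div => /(_ _ _); rewrite divr_gt0 ?subr_gt0//.
  have -> : s^-1 + (s - 1) / s = 1 by field; rewrite gt_eqF.
  move=> /(_ isT erefl) h.
  have := ler_wpM2l (ltW s0) h.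
  by rewrite mulrDr mul1r !(mulrC s) !mulfVK ?gt_eqF.
have Iconst := has_mean_cst P (s - 1).
have := ler_rexp (has_meanZ s If) (has_meanD Ifs Iconst) young.
by rewrite rexpZ// rexpD// rexp_cst Ef1; lra.
Qed.

End PowerMoments.

(** * The population least squares problem *)

Section SampleSpace.
Context (R : realType) (d : nat).

Lemma measurable_coord (j : 'I_d) :
  measurable_fun setT (fun v : sample_space R d => v.1 j 0).
Proof.
apply: (measurableT_comp (f := fun u : borelType 'cV[R]_d => (u : 'cV[R]_d) j 0)) => //.
apply: (measurability _ (RGenOInfty.measurableE R)).
move=> _ [_ [a ->] <-]; rewrite setTI; apply: sub_sigma_algebra.
apply: open_comp => [u _|]; first exact: coord_continuous.
exact: interval_open.
Qed.

Lemma measurable_dot_fst (h : 'cV[R]_d) :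
  measurable_fun setT (fun v : sample_space R d => dot h v.1).
Proof.
under eq_fun do rewrite dotE.
by apply: measurable_sum => j; apply: measurable_funM => //; exact: measurable_coord.
Qed.

Lemma measurable_residual (h : 'cV[R]_d) :
  measurable_fun setT (fun v : sample_space R d => v.2 - dot h v.1).
Proof.
by apply: measurable_funB; [exact: measurable_snd|exact: measurable_dot_fst].
Qed.

End SampleSpace.

(** First-order condition for a quadratic function minimal at 0, obtained at
    [t = - b / (c + 1)] so as not to divide by [c]. *)
Lemma quadratic_min_linear0 (R : realType) (b c : R) :
  (forall t, 0 <= t * b + t ^+ 2 * c) -> b = 0.
Proof.
move=> pos; apply/eqP; rewrite -sqrf_eq0 eq_le sqr_ge0 andbT.
have c0 : 0 <= c by have := pos 1; have := pos (-1); lra.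
have c1 : 0 < c + 1 by lra.
have := pos (- b / (c + 1)).
have -> : - b / (c + 1) * b + (- b / (c + 1)) ^+ 2 * c = - b ^+ 2 / (c + 1) ^+ 2.
  by field; rewrite gt_eqF.
by rewrite pmulr_lge0 ?invr_gt0 ?exprn_gt0// oppr_ge0.
Qed.

Section SquareIntegrable.
Context dT (T : measurableType dT) (R : realType) (P : probability T R).

Lemma has_mean_mul (f g : T -> R) : measurable_fun setT f -> measurable_fun setT g ->
  has_mean P (fun w => f w ^+ 2) -> has_mean P (fun w => g w ^+ 2) ->
  has_mean P (fun w => f w * g w).
Proof.
move=> mf mg If Ig; apply: (le_has_mean _ (has_meanD If Ig)).
  exact: measurable_funM.
move=> w; rewrite normrM -(real_normK (num_real (f w))) -(real_normK (num_real (g w))).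
by have := sqr_ge0 (`|f w| - `|g w|); have := normr_ge0 (f w);
  have := normr_ge0 (g w); nra.
Qed.

Lemma expectation_has_mean (f : T -> R) : measurable_fun setT f ->
  (forall w, 0 <= f w) -> ('E_P[f] < +oo)%E -> has_mean P f.
Proof. by move=> mf f0; rewrite unlock => fin; exact: ge0_has_mean. Qed.

End SquareIntegrable.

Section LeastSquares.
Context (R : realType) (d : nat) (dT : measure_display) (T : measurableType dT)
  (P : probability T R) (Z : {RV P >-> sample_space R d}).
Hypotheses (X2fin : ('E_P[fun w => (enorm (Z w).1 ^+ 2)%R] < +oo)%E)
  (Y2fin : ('E_P[fun w => ((Z w).2 ^+ 2)%R] < +oo)%E).
Implicit Types (theta h : 'cV[R]_d) (xi : R).

Let G := gram P Z.

Lemma mdot_Z h : measurable_fun setT (fun w => dot h (Z w).1).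
Proof. exact: (measurableT_comp (measurable_dot_fst h)). Qed.

Lemma mY_Z : measurable_fun setT (fun w => (Z w).2).
Proof. exact: (measurableT_comp (@measurable_snd _ _ _ _)). Qed.

Lemma mresidual_Z theta : measurable_fun setT (residual Z theta).
Proof. exact: (measurableT_comp (measurable_residual theta)). Qed.

Lemma mean_dotX2 h : has_mean P (fun w => dot h (Z w).1 ^+ 2).
Proof.
have mX2 : measurable_fun setT (fun w => enorm (Z w).1 ^+ 2).
  under eq_fun do rewrite /enorm sqr_sqrtr ?dot_sqr_ge0// dotE.
  apply: measurable_sum => j; apply: measurable_funM;
    exact: (measurableT_comp (measurable_coord j)).
have IX2 : has_mean P (fun w => enorm (Z w).1 ^+ 2).
  by apply: expectation_has_mean => // w; exact: sqr_ge0.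
apply: (le_has_mean _ (has_meanZ (dot h h) IX2)).
  by apply: measurable_funX; exact: mdot_Z.
move=> w; rewrite ger0_norm ?sqr_ge0// /enorm sqr_sqrtr ?dot_sqr_ge0//.
exact: cauchy_schwarz.
Qed.

Lemma mean_Y2 : has_mean P (fun w => (Z w).2 ^+ 2).
Proof.
apply: expectation_has_mean => // [|w]; last exact: sqr_ge0.
by apply: measurable_funX; exact: mY_Z.
Qed.

Lemma mean_residual2 theta : has_mean P (fun w => residual Z theta w ^+ 2).
Proof.
apply: (le_has_mean _ (has_meanZ 2 (has_meanD mean_Y2 (mean_dotX2 theta)))).
  by apply: measurable_funX; exact: mresidual_Z.
move=> w; rewrite ger0_norm ?sqr_ge0// /residual.
by have := sqr_ge0 ((Z w).2 + dot theta (Z w).1); nra.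
Qed.

Lemma mean_residual_dotX theta h :
  has_mean P (fun w => residual Z theta w * dot h (Z w).1).
Proof.
by apply: has_mean_mul; [exact: mresidual_Z|exact: mdot_Z|exact: mean_residual2|
  exact: mean_dotX2].
Qed.

Lemma entryE (v : 'cV[R]_d) j : v j 0 = dot (delta_mx j 0) v.
Proof.
rewrite dotE (bigD1 j)//= mxE !eqxx mul1r big1 ?addr0// => i ij.
by rewrite mxE (negPf ij) mul0r.
Qed.

Lemma rexp_dotX_dotX h h' :
  rexpectation P (fun w => dot h (Z w).1 * dot h' (Z w).1) = dot h (G *m h').
Proof.
have Iij i j : has_mean P (fun w => (Z w).1 i 0 * (Z w).1 j 0).
  have -> : (fun w => (Z w).1 i 0 * (Z w).1 j 0) =
      (fun w => dot (delta_mx i 0) (Z w).1 * dot (delta_mx j 0) (Z w).1).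
    by apply/funext => w; rewrite -!entryE.
  by apply: has_mean_mul; [exact: mdot_Z|exact: mdot_Z|exact: mean_dotX2|
    exact: mean_dotX2].
have GE i j : G i j = rexpectation P (fun w => (Z w).1 i 0 * (Z w).1 j 0).
  rewrite mxE; congr (rexpectation P); apply/funext => w.
  by rewrite mxE big_ord1 mxE.
have Iterm i j : has_mean P (fun w => (h i 0 * h' j 0) * ((Z w).1 i 0 * (Z w).1 j 0)).
  exact: has_meanZ.
transitivity (rexpectation P (fun w => \sum_i \sum_j
    (h i 0 * h' j 0) * ((Z w).1 i 0 * (Z w).1 j 0))).
  congr (rexpectation P); apply/funext => w; rewrite !dotE mulr_suml.
  by apply: eq_bigr => i _; rewrite mulr_sumr; apply: eq_bigr => j _; ring.
rewrite rexp_sum; last by move=> i; exact: has_mean_sum.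
rewrite dotE; apply: eq_bigr => i _; rewrite rexp_sum// mxE mulr_sumr.
by apply: eq_bigr => j _; rewrite rexpZ// GE; ring.
Qed.

Lemma gram_sym : G^T = G.
Proof.
apply/matrixP => i j; rewrite !mxE; congr (rexpectation P); apply/funext => w.
by rewrite !mxE !big_ord1 !mxE mulrC.
Qed.

Lemma risk_shift theta h :
  risk P Z (theta + h) = risk P Z theta
    - 2 * rexpectation P (fun w => residual Z theta w * dot h (Z w).1)
    + dot h (G *m h).
Proof.
rewrite -rexp_dotX_dotX /risk.
have -> : (fun w => residual Z (theta + h) w ^+ 2) = (fun w => (residual Z theta w ^+ 2
    + (-2) * (residual Z theta w * dot h (Z w).1)) + dot h (Z w).1 * dot h (Z w).1).
  by apply/funext => w; rewrite /residual dotDl; ring.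
have I1 := has_meanZ (-2) (mean_residual_dotX theta h).
have I2 := has_meanD (mean_residual2 theta) I1.
rewrite rexpD//; last exact: mean_dotX2.
rewrite rexpD//; last exact: mean_residual2.
by rewrite rexpZ ?mulNr//; exact: mean_residual_dotX.
Qed.

Section Minimizer.
Variable theta_star : 'cV[R]_d.
Hypothesis minim : argmin (risk P Z) theta_star.

Lemma residual_orthogonal h :
  rexpectation P (fun w => residual Z theta_star w * dot h (Z w).1) = 0.
Proof.
set b := rexpectation P _.
suff : - 2 * b = 0 by move=> /eqP; rewrite mulf_eq0 oppr_eq0 pnatr_eq0/= => /eqP.
apply: (@quadratic_min_linear0 _ _ (dot h (G *m h))) => t.
have := minim (theta_star + t *: h); rewrite risk_shift.
have -> : rexpectation P (fun w => residual Z theta_star w * dot (t *: h) (Z w).1) = t * b.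
  rewrite -rexpZ; last exact: mean_residual_dotX.
  by congr (rexpectation P); apply/funext => w; rewrite dotZl; ring.
by rewrite -scalemxAr dotZl dotZr expr2; lra.
Qed.

(** [xi Y - <theta, X> = xi r - <h, X>] with [r] the residual at [theta_star], and
    [r] is orthogonal to every linear function of [X]. *)
Lemma quadE theta xi : let h := theta - xi *: theta_star in
  quad P Z theta xi = xi ^+ 2 * risk P Z theta_star + dot h (G *m h).
Proof.
move=> h; rewrite /quad /risk -rexp_dotX_dotX.
have -> : (fun w => (xi * (Z w).2 - dot theta (Z w).1) ^+ 2) =
    (fun w => (xi ^+ 2 * residual Z theta_star w ^+ 2
    + (-2 * xi) * (residual Z theta_star w * dot h (Z w).1))
    + dot h (Z w).1 * dot h (Z w).1).
  by apply/funext => w; rewrite /residual /h dotBl dotZl; ring.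
have I0 := has_meanZ (xi ^+ 2) (mean_residual2 theta_star).
have I1 := has_meanZ (-2 * xi) (mean_residual_dotX theta_star h).
have I2 := has_meanD I0 I1.
rewrite rexpD//; last exact: mean_dotX2.
rewrite rexpD// rexpZ; last exact: mean_residual2.
rewrite rexpZ; last exact: mean_residual_dotX.
by rewrite residual_orthogonal mulr0 addr0.
Qed.

Lemma riskE h : risk P Z (theta_star + h) = risk P Z theta_star + dot h (G *m h).
Proof. by rewrite risk_shift residual_orthogonal mulr0 subr0. Qed.

End Minimizer.

End LeastSquares.

(** * Excess risk of an empirical minimizer *)

Lemma symmetric_comparison (R : realType) (m r N t del : R) :
  - (del * (r + (1 + t) ^+ 2 * N)) <= m - (r + (1 + t) ^+ 2 * N) ->
  m - (r + (1 + - t) ^+ 2 * N) <= del * (r + (1 + - t) ^+ 2 * N) ->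
  2 * t * N <= del * (r + N + t ^+ 2 * N).
Proof.
move=> h1 h2.
have diff : (r + (1 + t) ^+ 2 * N) - (r + (1 + - t) ^+ 2 * N) = 2 * (2 * t * N) by ring.
have sum : del * (r + (1 + t) ^+ 2 * N) + del * (r + (1 + - t) ^+ 2 * N) =
  2 * (del * (r + N + t ^+ 2 * N)) by ring.
by lra.
Qed.

Section ExcessRisk.
Context (R : realType) (d n : nat) (dT : measure_display) (T : measurableType dT)
  (P : probability T R) (Z : {RV P >-> sample_space R d})
  (Zs : 'I_n -> T -> sample_space R d).
Hypotheses (X2fin : ('E_P[fun w => (enorm (Z w).1 ^+ 2)%R] < +oo)%E)
  (Y2fin : ('E_P[fun w => ((Z w).2 ^+ 2)%R] < +oo)%E) (n0 : (0 < n)%N).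
Variables (theta_star theta_hat : 'cV[R]_d) (w : T) (del : R).
Hypotheses (minim : argmin (risk P Z) theta_star)
  (emp_minim : argmin (sum_squares Zs w) theta_hat)
  (del01 : 0 <= del < 1)
  (relative : forall theta xi,
    `|emp_quad Zs w theta xi - quad P Z theta xi| <= del * quad P Z theta xi).

Let nR : 0 < n%:R :> R. Proof. by rewrite ltr0n. Qed.

Let emp_quad1 theta : emp_quad Zs w theta 1 = n%:R^-1 * sum_squares Zs w theta.
Proof.
by rewrite /emp_quad; under eq_bigr do rewrite mul1r.
Qed.

Let sum_squares_shift h : exists C, forall t,
  sum_squares Zs w (theta_hat + t *: h) = sum_squares Zs w theta_hat + t ^+ 2 * C.
Proof.
pose C := \sum_i dot h (Zs i w).1 ^+ 2.
pose b := - 2 * \sum_i residual (Zs i) theta_hat w * dot h (Zs i w).1.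
have E t : sum_squares Zs w (theta_hat + t *: h) =
    sum_squares Zs w theta_hat + (t * b + t ^+ 2 * C).
  rewrite /sum_squares /b /C mulrA !mulr_sumr -!big_split/=; apply: eq_bigr => i _.
  by rewrite /residual dotDl dotZl; ring.
have b0 : b = 0.
  by apply: (@quadratic_min_linear0 _ b C) => t; have := emp_minim (theta_hat + t *: h);
    rewrite E lerDl.
by exists C => t; rewrite E b0 mulr0 add0r.
Qed.

(** In terms of [N], the excess risk, and [r], the minimal risk: minimality of
    [theta_hat] removes the cross term of the empirical form, whereas the population
    form has the cross term [2 t N] along [theta_hat + t h]; the relative deviation
    forces it to be small, namely [2 t N <= del (r + N + t^2 N)]. *)
Lemma excess_risk :
  risk P Z theta_hat - risk P Z theta_star
    <= del ^+ 2 / ((1 - del) * (1 - del ^+ 2) * n%:R) * sum_squares Zs w theta_hat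
  /\ del ^+ 2 / ((1 - del) * (1 - del ^+ 2) * n%:R) * sum_squares Zs w theta_hat
    <= del ^+ 2 / (1 - del) ^+ 2 * risk P Z theta_star.
Proof.
have [del0 del1] := andP del01.
pose h := theta_hat - theta_star.
pose N := dot h (gram P Z *m h).
set r := risk P Z theta_star; set S := sum_squares Zs w theta_hat.
have riskE' t : risk P Z (theta_star + t *: h) = r + t ^+ 2 * N.
  by rewrite riskE// -scalemxAr dotZl dotZr mulrA expr2.
have r0 : 0 <= r by apply: rexp_ge0 => v; exact: sqr_ge0.
have N0 : 0 <= N.
  by rewrite /N -rexp_dotX_dotX//; apply: rexp_ge0 => v; rewrite -expr2 sqr_ge0.
have hE : theta_star + h = theta_hat by rewrite /h addrC subrK.
have hatE t : theta_hat + t *: h = theta_star + (1 + t) *: h.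
  by rewrite scalerDl scale1r addrA hE.
have quad1 theta : quad P Z theta 1 = risk P Z theta.
  by rewrite /quad /risk /residual; under eq_fun do rewrite mul1r.
have risk_hat : risk P Z theta_hat = r + N.
  by have := riskE' 1; rewrite scale1r expr1n mul1r hE.
have [C SE] := sum_squares_shift h.
have ratio t : `|n%:R^-1 * (S + t ^+ 2 * C) - (r + (1 + t) ^+ 2 * N)|
    <= del * (r + (1 + t) ^+ 2 * N).
  by have := relative (theta_hat + t *: h) 1; rewrite emp_quad1 quad1 SE hatE riskE'.
(* The empirical form is even in t along theta_hat + t h while the population
   form is centred at theta_star, so comparing t with - t isolates N. *)
have key t : 2 * t * N <= del * (r + N + t ^+ 2 * N).
  have := ratio t; have := ratio (- t); rewrite sqrrN.
  move: (n%:R^-1 * _) => m; rewrite !ler_norml => /andP[_ h1] /andP[h2 _].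
  exact: symmetric_comparison h2 h1.
have Sle : S <= sum_squares Zs w theta_star := emp_minim theta_star.
have ratio_star : `|n%:R^-1 * sum_squares Zs w theta_star - r| <= del * r.
  by have := relative theta_star 1; rewrite emp_quad1 quad1.
rewrite risk_hat; clearbody r S N.
(* In the extremal case N = del^2 (r + N) the optimal t in key is 1 / del. *)
have Nle : N <= del ^+ 2 * (r + N).
  have [del_eq0|del_neq0] := eqVneq del 0.
    by have := key 1; rewrite del_eq0 expr0n/=; lra.
  have delp : 0 < del by rewrite lt0r del_neq0.
  have := key del^-1; rewrite -(ler_pM2l delp).
  rewrite (_ : del * (2 * del^-1 * N) = 2 * N); last by field.
  rewrite (_ : del * (del * _) = del ^+ 2 * (r + N) + N); last by field.
  by lra.
have S_low : (1 - del) * (r + N) <= n%:R^-1 * S.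
  have := ratio 0; rewrite expr0n mul0r !addr0 expr1n mul1r ler_norml.
  by move=> /andP[+ _]; lra.
have S_upp : n%:R^-1 * S <= (1 + del) * r.
  apply: (@le_trans _ _ (n%:R^-1 * sum_squares Zs w theta_star)).
    by rewrite ler_wpM2l ?invr_ge0// ltW.
  by move: ratio_star; rewrite ler_norml => /andP[_]; lra.
have d2 : 0 < 1 - del ^+ 2 by nra.
have d1 : 0 < 1 - del by lra.
have e0 : 0 <= n%:R^-1 * S 
  by apply: le_trans S_low; apply: mulr_ge0; [exact: ltW|exact: addr_ge0].
have E : del ^+ 2 / ((1 - del) * (1 - del ^+ 2) * n%:R) * S =
    del ^+ 2 / ((1 - del) * (1 - del ^+ 2)) * (n%:R^-1 * S).
  by field; rewrite !gt_eqF.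
rewrite E; split.
  rewrite addrAC subrr add0r; apply: (le_trans Nle).
  rewrite -[leRHS]mulrA ler_wpM2l ?sqr_ge0// mulrC ler_pdivlMr ?mulr_gt0//.
  apply: le_trans S_low; rewrite mulrC -mulrA ler_wpM2l ?(ltW d1)//.
  by rewrite ler_piMl ?addr_ge0// lerBlDr lerDl sqr_ge0.
have -> : del ^+ 2 / (1 - del) ^+ 2 * r =
    del ^+ 2 / ((1 - del) * (1 - del ^+ 2)) * ((1 + del) * r).
  by field; rewrite !gt_eqF.
by rewrite ler_wpM2l// divr_ge0 ?sqr_ge0// mulr_ge0// ltW.
Qed.

End ExcessRisk.

(** * Whitening *)

Section AlmostSure.
Context dT (T : measurableType dT) (R : realType) (P : probability T R).

Lemma ae_has_mean (f g : T -> R) : measurable_fun setT f -> (forall w, 0 <= f w) ->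
  has_mean P g -> {ae P, forall w, f w = g w} -> has_mean P f.
Proof.
move=> mf f0 Ig fg; have Ig' : has_mean P (fun w => `|g w|).
  apply: (integrable_norm); exact: Ig.
apply: ge0_has_mean => //.
rewrite (@ge0_ae_eq_integral _ _ _ P setT _ (fun w => `|g w|%:E))//.
- by rewrite -EFin_rexp// ltry.
- exact/measurable_EFinP.
- by case/integrableP: Ig'.
- by move=> w _; rewrite lee_fin.
- by apply: filterS fg => w fgw _ /=; rewrite -fgw ger0_norm.
Qed.

Lemma with_probability_ae (q : R) (E Q : set T) :
  with_probability_at_least P q E -> {ae P, forall w, Q w} ->
  with_probability_at_least P q (E `&` Q).
Proof.
move=> [A [mA AE qA]] [N [mN PN0 QN]].
exists (A `\` N); split; first exact: measurableD.
- by move=> w [Aw Nw]; split; [exact: AE|apply: contrapT => Qw; apply: Nw; exact: QN].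
- apply: (le_trans qA); have AU : A `<=` (A `\` N) `|` N.
    by move=> w Aw; have [Nw|Nw] := pselect (N w); [right|left].
  have mD := measurableD mA mN.
  apply: (@le_trans _ _ (P ((A `\` N) `|` N))).
    by apply: le_measure; rewrite ?inE//; exact: measurableU.
  apply: (le_trans (measureU2 _ mD mN)).
  by rewrite -[leRHS]adde0; apply: leeD => //; rewrite -PN0.
Qed.

Lemma ae_forall_ord n (Q : 'I_n -> T -> Prop) :
  (forall i, {ae P, forall w, Q i w}) -> {ae P, forall w i, Q i w}.
Proof.
move=> h; suff : forall s : seq 'I_n, {ae P, forall w i, i \in s -> Q i w}.
  by move=> /(_ (enum 'I_n)); apply: filterS => w Qw i; apply: Qw; rewrite mem_enum.
elim=> [|j s IH]; first by apply: aeW => w i.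
apply: filterS2 (h j) IH => w Qj Qs i.
by rewrite inE => /orP[/eqP ->//|]; exact: Qs.
Qed.

End AlmostSure.

Section ColumnPairs.
Context (R : realType) (d : nat).
Implicit Types (a b : 'cV[R]_d) (s t : R).

Definition append a s : 'cV[R]_(d + 1) := col_mx a (const_mx s).

Lemma dot_append a b s t : dot (append a s) (append b t) = dot a b + s * t.
Proof.
rewrite !dotE big_split_ord/= big_ord1; congr (_ + _).
  by apply: eq_bigr => j _; rewrite !col_mxEu.
by rewrite !col_mxEd !mxE.
Qed.

Lemma appendP (u : 'cV[R]_(d + 1)) : exists a s, u = append a s.
Proof.
exists (usubmx u), (dsubmx u 0 0); rewrite -[LHS]vsubmxK; congr (col_mx _ _).
by apply/colP => j; rewrite ord1 !mxE.
Qed.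

End ColumnPairs.

(** To be read with [x] and [y] the [L^4] norms of two variables with second moments
    [A] and [B] and kurtosis at most [a^2] and [b^2]: the kurtosis of an orthogonal
    sum is at most [(a + b)^2]. *)
Lemma quartic_root_bound (R : realType) (a b A B x y : R) :
  0 <= a -> 0 <= b -> 0 <= A -> 0 <= B -> 0 <= x -> 0 <= y ->
  x ^+ 2 <= a * A -> y ^+ 2 <= b * B -> (x + y) ^+ 4 <= (a + b) ^+ 2 * (A + B) ^+ 2.
Proof.
move=> a0 b0 A0 B0 x0 y0 xA yB.
have sq2 : (x + y) ^+ 2 <= (a + b) * (A + B).
  have cross : 2 * (x * y) <= a * B + b * A.
    rewrite -(@ler_pXn2r _ 2)// ?nnegrE ?addr_ge0 ?mulr_ge0//.
    apply: (@le_trans _ _ (4 * ((a * A) * (b * B)))).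
      have := ler_pM (sqr_ge0 x) (sqr_ge0 y) xA yB.
      by rewrite !exprMn; lra.
    by have := sqr_ge0 (a * B - b * A); rewrite !expr2; lra.
  by move: cross xA yB; rewrite !expr2; lra.
rewrite -exprMn (exprM _ 2 2) lerXn2r// ?nnegrE ?sqr_ge0//.
by rewrite mulr_ge0 ?addr_ge0.
Qed.

Section Whitening.
Context (R : realType) (d : nat) (dT : measure_display) (T : measurableType dT)
  (P : probability T R) (Z : {RV P >-> sample_space R d})
  (theta_star : 'cV[R]_d) (S : 'M[R]_d).
Hypotheses (X2fin : ('E_P[fun w => (enorm (Z w).1 ^+ 2)%R] < +oo)%E)
  (Y2fin : ('E_P[fun w => ((Z w).2 ^+ 2)%R] < +oo)%E)
  (minim : argmin (risk P Z) theta_star)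
  (r0 : 0 < risk P Z theta_star)
  (hS : is_sqrt_pseudo_inverse (gram P Z) S).

Let G := gram P Z.
Let r := risk P Z theta_star.
Let sym_S : S^T = S. Proof. by case: hS. Qed.
Let sym_G : G^T = G. Proof. exact: gram_sym. Qed.
Let pinv : is_pseudo_inverse G (S *m S). Proof. by case: hS. Qed.

Let dotS (a b : 'cV[R]_d) : dot (S *m a) b = dot a (S *m b).
Proof. by rewrite dot_mulmx sym_S. Qed.

Let dotG (a b : 'cV[R]_d) : dot (G *m a) b = dot a (G *m b).
Proof. by rewrite dot_mulmx sym_G. Qed.

Let GSSG (a : 'cV[R]_d) : G *m (S *m (S *m (G *m a))) = G *m a.
Proof. by have [E _ _ _] := pinv; rewrite -[in RHS]E !mulmxA. Qed.

(** The second moment matrix of [whiten Z] is an orthogonal projection: [S G S] on the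
    first [d] coordinates, and 1 on the last one. *)
Definition whiten (v : sample_space R d) : 'cV[R]_(d + 1) :=
  append (S *m v.1) ((v.2 - dot theta_star v.1) / Num.sqrt r).

Let sr0 : 0 < Num.sqrt r. Proof. by rewrite sqrtr_gt0. Qed.
Let sr2 : Num.sqrt r ^+ 2 = r. Proof. by rewrite sqr_sqrtr// ltW. Qed.

Lemma measurable_whiten j : measurable_fun setT (fun v => whiten v j 0).
Proof.
case: (split_ordP j) => k ->.
  under eq_fun do rewrite col_mxEu mxE.
  by apply: measurable_sum => l; apply: measurable_funM => //; exact: measurable_coord.
under eq_fun do rewrite col_mxEd mxE.
by apply: measurable_funM => //; exact: measurable_residual.
Qed.

Lemma dot_whiten a s v : dot (append a s) (whiten v) =
  dot (S *m a) v.1 + s / Num.sqrt r * (v.2 - dot theta_star v.1).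
Proof. by rewrite dot_append dotS; congr (_ + _); ring. Qed.

Lemma whitened_form a s :
  rexpectation P (fun w => dot (append a s) (whiten (Z w)) ^+ 2) =
  dot (S *m a) (G *m (S *m a)) + s ^+ 2.
Proof.
pose xi := s / Num.sqrt r.
have := quadE X2fin Y2fin minim (- (S *m a) + xi *: theta_star) xi.
rewrite /= addrK mulmxN dotNl dotNr opprK -/G -/r.
have -> : xi ^+ 2 * r = s ^+ 2.
  by rewrite /xi expr_div_n sr2; field; rewrite gt_eqF.
rewrite [RHS]addrC => <-; congr (rexpectation P); apply/funext => w.
by rewrite dot_whiten dotDl dotNl dotZl -/xi; ring.
Qed.

(** [S G S] is symmetric and idempotent because [S^2] is the pseudo-inverse of [G]. *)
Lemma whitened_form_le u :
  rexpectation P (fun w => dot u (whiten (Z w)) ^+ 2) <= dot u u.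
Proof.
have [a [s ->]] := appendP u; rewrite whitened_form dot_append -expr2 lerD2r.
rewrite dotS; set b := S *m (G *m (S *m a)).
have bb : dot b b = dot a b by rewrite {1}/b dotS dotG dotS /b GSSG.
have := dot_sqr_ge0 (a - b); rewrite dotBl !dotBr bb (dotC b a); lra.
Qed.

(** The component of [X] along [e_j - S S G e_j] has second moment zero, these vectors
    being in the kernel of [G]. *)
Lemma ae_range : {ae P, forall w, (Z w).1 = G *m (S *m (S *m (Z w).1))}.
Proof.
pose e (j : 'I_d) : 'cV[R]_d := delta_mx j 0.
pose h j := e j - S *m (S *m (G *m e j)).
have hE (j : 'I_d) (v : 'cV[R]_d) : v j 0 - (G *m (S *m (S *m v))) j 0 = dot (h j) v.
  by rewrite !entryE -/(e j) /h dotBl !dotS -dotG.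
have h0 j : rexpectation P (fun w => dot (h j) (Z w).1 ^+ 2) = 0.
  rewrite (rexp_dotX_dotX X2fin) -/G /h mulmxBr GSSG subrr dotC dot0l//.
have ae0 j : {ae P, forall w, dot (h j) (Z w).1 ^+ 2 = 0}.
  apply: rexp_eq0_ae (h0 j); first exact: mean_dotX2.
  by move=> w; exact: sqr_ge0.
apply: filterS (ae_forall_ord ae0) => w hw; apply/colP => j.
by apply/eqP; rewrite -subr_eq0 hE -sqrf_eq0 hw.
Qed.

(** The coordinates of [xi Y - <theta, X>] with respect to [whiten]. They are isometric
    for the population form because [(S G)^T (S G) = G]. *)
Definition whitened_vector theta (xi : R) : 'cV[R]_(d + 1) :=
  append (- (S *m (G *m (theta - xi *: theta_star)))) (xi * Num.sqrt r).

Lemma dot_whitened_vector theta xi v : v.1 = G *m (S *m (S *m v.1)) ->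
  dot (whitened_vector theta xi) (whiten v) = xi * v.2 - dot theta v.1.
Proof.
move=> vE; rewrite /whitened_vector dot_whiten mulfK ?gt_eqF// mulmxN dotNl.
rewrite !dotS dotG -vE dotBl dotZl; ring.
Qed.

Lemma whitened_vector_norm theta xi :
  dot (whitened_vector theta xi) (whitened_vector theta xi) = quad P Z theta xi.
Proof.
rewrite (quadE X2fin Y2fin minim)/= dot_append dotNl dotNr opprK addrC -expr2.
by rewrite exprMn sr2; congr (_ + _); rewrite dotS dotG GSSG.
Qed.

Lemma whitened_vector_form theta xi :
  rexpectation P (fun w => dot (whitened_vector theta xi) (whiten (Z w)) ^+ 2) =
  quad P Z theta xi.
Proof.
rewrite whitened_form -whitened_vector_norm dot_append dotNl dotNr opprK -expr2.
by congr (_ + _); rewrite !mulmxN dotNl dotNr opprK GSSG; exact: dotS.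
Qed.

Variable p : R.
Hypotheses (p1 : 1 < p)
  (rfin : ('E_P[fun w => (`|residual Z theta_star w| `^ (4 * p + 4))%R] < +oo)%E)
  (wfin : ('E_P[fun w => (enorm (S *m (Z w).1) `^ (4 * p + 4))%R] < +oo)%E).

Let lower_moment (f : T -> R) (s s' : R) : measurable_fun setT f ->
  (forall w, 0 <= f w) -> 0 <= s <= s' -> has_mean P (fun w => f w `^ s') ->
  has_mean P (fun w => f w `^ s).
Proof.
move=> mf f0 /andP[s0 ss'] If.
apply: (le_has_mean _ (has_meanD (has_mean_cst P 1) If)).
  exact: (measurableT_comp (measurable_powR s)).
move=> w; rewrite ger0_norm ?powR_ge0//.
have := powR_ge0 (f w) s'; have [f1|f1] := leP (f w) 1.
  have := ge0_ler_powR s0 (f0 w : f w \in Num.nneg) (ler01 : 1 \in Num.nneg) f1.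
  by rewrite powR1; lra.
by have := ler_powR (ltW f1) ss'; lra.
Qed.

Let mres : measurable_fun setT (residual Z theta_star).
Proof. exact: mresidual_Z. Qed.

Let menorm : measurable_fun setT (fun w => enorm (S *m (Z w).1)).
Proof.
under eq_fun do rewrite /enorm -powR12_sqrt ?dot_sqr_ge0// dotE.
apply: (measurableT_comp (measurable_powR _)); apply: measurable_sum => j.
have mj : measurable_fun setT (fun w => (S *m (Z w).1) j 0).
  under eq_fun do rewrite mxE.
  apply: measurable_sum => l; apply: measurable_funM => //.
  exact: (measurableT_comp (measurable_coord l)).
exact: measurable_funM.
Qed.

Let enorm0 (a : 'cV[R]_d) : 0 <= enorm a. Proof. exact: sqrtr_ge0. Qed.

Let mean_abs_residual s : 0 <= s <= 4 * p + 4 ->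
  has_mean P (fun w => `|residual Z theta_star w| `^ s).
Proof.
move=> hs; apply: (lower_moment _ _ hs) => //; first exact: measurableT_comp.
apply: expectation_has_mean => //.
by apply: (measurableT_comp (measurable_powR _)); exact: measurableT_comp.
Qed.

Let mean_enorm s : 0 <= s <= 4 * p + 4 ->
  has_mean P (fun w => enorm (S *m (Z w).1) `^ s).
Proof.
move=> hs; apply: (lower_moment menorm (fun w => enorm0 _) hs).
apply: expectation_has_mean => //.
  exact: (measurableT_comp (measurable_powR _)).
by move=> w; exact: powR_ge0.
Qed.

Let enorm_powR (a : 'cV[R]_d) s : enorm a `^ (2 * s) = dot a a `^ s.
Proof.
by rewrite /enorm -powR12_sqrt ?dot_sqr_ge0// -powRrM mulrA mulVf ?mul1r.
Qed.

Let abs_powR (y s : R) : `|y| `^ (2 * s) = (y ^+ 2) `^ s.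
Proof. by rewrite powRrM powR_mulrn// real_normK ?num_real. Qed.

Lemma whiten_sqr v : dot (whiten v) (whiten v) =
  (v.2 - dot theta_star v.1) ^+ 2 / r + dot (S *m v.1) (S *m v.1).
Proof. by rewrite dot_append addrC -expr2 expr_div_n sr2. Qed.

Let res2 w : R := residual Z theta_star w ^+ 2 / r.
Let enorm2 w : R := dot (S *m (Z w).1) (S *m (Z w).1).

Let res20 w : 0 <= res2 w. Proof. by rewrite divr_ge0 ?sqr_ge0// ltW. Qed.

Let mres2 : measurable_fun setT res2.
Proof. by apply: measurable_funM => //; exact: measurable_funX. Qed.

Let menorm2 : measurable_fun setT enorm2.
Proof.
have -> : enorm2 = (fun w => enorm (S *m (Z w).1) ^+ 2).
  by apply/funext => w; rewrite sqr_sqrtr// dot_sqr_ge0.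
exact: measurable_funX.
Qed.

Let res2_powR s w : res2 w `^ s = (r^-1) `^ s * `|residual Z theta_star w| `^ (2 * s).
Proof.
by rewrite powRM ?sqr_ge0 ?invr_ge0 ?(ltW r0)// abs_powR mulrC.
Qed.

Let mean_res2 s : 0 <= s -> 2 * s <= 4 * p + 4 -> has_mean P (fun w => res2 w `^ s).
Proof.
move=> s0 hs; under eq_fun do rewrite res2_powR; apply: has_meanZ.
by apply: mean_abs_residual; rewrite mulr_ge0.
Qed.

(** Minkowski's inequality in [L^s] for [|W|^2 = r^2 / R0 + |S X|^2]. *)
Lemma whiten_moment s : 1 <= s -> 2 * s <= 4 * p + 4 ->
  has_mean P (fun w => dot (whiten (Z w)) (whiten (Z w)) `^ s) /\
  rexpectation P (fun w => dot (whiten (Z w)) (whiten (Z w)) `^ s) <=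
  (residual_moment P Z theta_star (2 * s) `^ s^-1 / r
   + white_moment P Z S (2 * s) `^ s^-1) `^ s.
Proof.
move=> s1 hs; have s0 : 0 < s by lra.
have Ienorm2 : has_mean P (fun w => enorm2 w `^ s).
  under eq_fun do rewrite -enorm_powR.
  by apply: mean_enorm; rewrite mulr_ge0// ltW.
have := rexp_minkowski s1 mres2 menorm2 res20 (fun w => dot_sqr_ge0 _)
  (mean_res2 (ltW s0) hs) Ienorm2.
have -> : (fun w => (res2 w + enorm2 w) `^ s) =
    (fun w => dot (whiten (Z w)) (whiten (Z w)) `^ s).
  by apply/funext => w; rewrite whiten_sqr.
have -> : rexpectation P (fun w => enorm2 w `^ s) = white_moment P Z S (2 * s).
  by congr (rexpectation P); apply/funext => w; rewrite -enorm_powR.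
have -> : rexpectation P (fun w => res2 w `^ s) =
    (r^-1) `^ s * residual_moment P Z theta_star (2 * s).
  under [in X in rexpectation _ X]eq_fun do rewrite res2_powR.
  by rewrite rexpZ//; apply: mean_abs_residual; rewrite hs mulr_ge0// ltW.
rewrite powRM ?powR_ge0//; last by apply: rexp_ge0 => w; exact: powR_ge0.
by rewrite -powRrM divff ?gt_eqF// powRr1 ?invr_ge0 ?(ltW r0)// mulrC.
Qed.

Lemma whiten_moment_ge1 s : 1 < s -> 2 * s <= 4 * p + 4 ->
  1 <= rexpectation P (fun w => dot (whiten (Z w)) (whiten (Z w)) `^ s).
Proof.
move=> s1 hs; have s0 : 0 < s by lra.
have I1 : has_mean P res2.
  rewrite /res2; under eq_fun do rewrite mulrC.
  by apply: has_meanZ; exact: mean_residual2.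
have E1 : rexpectation P res2 = 1.
  rewrite /res2; under [in X in rexpectation _ X]eq_fun do rewrite mulrC.
  rewrite rexpZ; last exact: mean_residual2.
  by rewrite -[rexpectation _ _]/r mulVf ?gt_eqF.
have Is := mean_res2 (ltW s0) hs.
apply: (le_trans (rexp_powR_ge1 s1 res20 I1 Is E1)).
have [Iw _] := whiten_moment (ltW s1) hs.
apply: ler_rexp => // w; rewrite whiten_sqr -/(res2 w) -/(enorm2 w).
have e0 : 0 <= enorm2 w := dot_sqr_ge0 _.
apply: ge0_ler_powR; first exact: ltW.
- by rewrite nnegrE.
- by rewrite nnegrE addr_ge0.
- by rewrite lerDl.
Qed.

Let M := rexpectation P (fun w => enorm2 w ^+ 2).

Let mean_enorm4 : has_mean P (fun w => enorm2 w ^+ 2).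
Proof.
have := @mean_enorm 4; rewrite (_ : (fun w => _) = (fun w => enorm2 w ^+ 2)).
  by apply; have := p1; lra.
apply/funext => w; rewrite (_ : 4 = 2 * 2%:R :> R); last by rewrite -natrM.
by rewrite enorm_powR powR_mulrn// dot_sqr_ge0.
Qed.

Let dot_range h w : (Z w).1 = G *m (S *m (S *m (Z w).1)) ->
  dot h (Z w).1 = dot (S *m (G *m h)) (S *m (Z w).1).
Proof. by move=> {1}->; rewrite dotS dotG. Qed.

(** [<h, X> = <S G h, S X>] almost surely and [|S G h|^2 = <h, G h>], so that fourth
    moments in all directions are controlled by the one of [|S X|]. This makes the
    supremum defining [kappa1] finite. *)
Lemma dotX4_moment h : has_mean P (fun w => dot h (Z w).1 ^+ 4) /\
  rexpectation P (fun w => dot h (Z w).1 ^+ 4) <= dot h (G *m h) ^+ 2 * M.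
Proof.
pose f w : R := dot h (Z w).1 ^+ 4.
pose g w : R := dot (S *m (G *m h)) (S *m (Z w).1) ^+ 4.
have mf : measurable_fun setT f by apply: measurable_funX; exact: mdot_Z.
have mg : measurable_fun setT g.
  rewrite /g; under eq_fun do rewrite -dotS.
  by apply: measurable_funX; exact: mdot_Z.
have ge0 (y : R) : 0 <= y ^+ 4 by rewrite (exprM _ 2 2) sqr_ge0.
have gle w : g w <= dot h (G *m h) ^+ 2 * enorm2 w ^+ 2.
  rewrite /g (exprM _ 2 2) -exprMn lerXn2r ?nnegrE ?sqr_ge0//.
    rewrite mulr_ge0// ?dot_sqr_ge0// -(rexp_dotX_dotX X2fin).
    by apply: rexp_ge0 => v; rewrite -expr2 sqr_ge0.
  apply: (le_trans (cauchy_schwarz _ _)).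
  by rewrite dotS dotG GSSG.
have Ig : has_mean P g.
  apply: (le_has_mean mg (has_meanZ (dot h (G *m h) ^+ 2) mean_enorm4)) => w.
  by rewrite ger0_norm; [exact: gle|exact: ge0].
have fg : {ae P, forall w, f w = g w}.
  by apply: filterS ae_range => w /dot_range e; rewrite /f /g -e.
split; first by apply: (ae_has_mean mf _ Ig fg) => w; exact: ge0.
rewrite (ae_eq_rexp mf mg fg) /M -rexpZ//; apply: ler_rexp => //.
exact: has_meanZ.
Qed.

Let kset := [set 'E_P[fun w => (dot theta (Z w).1 ^+ 4)%R]%E |
  theta in [set theta | ('E_P[fun w => (dot theta (Z w).1 ^+ 2)%R] <= 1)%E]].

Let E2 h : ('E_P[fun w => (dot h (Z w).1 ^+ 2)%R] = (dot h (G *m h))%:E)%E.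
Proof.
rewrite unlock -EFin_rexp; last exact: mean_dotX2.
by rewrite -(rexp_dotX_dotX X2fin).
Qed.

Let E4 h : ('E_P[fun w => (dot h (Z w).1 ^+ 4)%R] =
  (rexpectation P (fun w => dot h (Z w).1 ^+ 4))%:E)%E.
Proof. by rewrite unlock -EFin_rexp//; have [] := dotX4_moment h. Qed.

Let form_ge0 h : 0 <= dot h (G *m h).
Proof.
by rewrite -(rexp_dotX_dotX X2fin); apply: rexp_ge0 => v; rewrite -expr2 sqr_ge0.
Qed.

Let kappa1_bounds : (0 <= ereal_sup kset)%E /\ (ereal_sup kset <= M%:E)%E.
Proof.
split.
  apply: (@le_trans _ _ 'E_P[fun w => (dot 0 (Z w).1 ^+ 4)%R]%E).
    by apply: expectation_ge0 => w; rewrite (exprM _ 2 2) sqr_ge0.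
  by apply: ereal_sup_ubound; exists 0 => //=; rewrite E2 dot0l lee_fin.
apply: ge_ereal_sup => _ [h /= + <-]; rewrite E2 E4 !lee_fin => h1.
apply: (le_trans (dotX4_moment h).2).
rewrite ler_piMl ?expr_le1//.
by apply: rexp_ge0 => w; exact: sqr_ge0.
Qed.

Lemma kappa1_ge0 : 0 <= kappa1 P Z.
Proof. by apply: fine_ge0; case: kappa1_bounds. Qed.

(** By homogeneity, up to directions with zero second moment, where both sides
    vanish. *)
Lemma dotX4_le h : rexpectation P (fun w => dot h (Z w).1 ^+ 4) <=
  kappa1 P Z * dot h (G *m h) ^+ 2.
Proof.
have supE : ((kappa1 P Z)%:E = ereal_sup kset)%E.
  rewrite /kappa1 fineK// ge0_fin_numE; last by case: kappa1_bounds.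
  exact: le_lt_trans kappa1_bounds.2 (ltry _).
have := form_ge0 h; rewrite le_eqVlt => /predU1P[q0|q0].
  by apply: (le_trans (dotX4_moment h).2); rewrite -q0 expr0n/= mul0r mulr0.
pose q := Num.sqrt (dot h (G *m h)).
have q1 : 0 < q by rewrite sqrtr_gt0.
have q2 : q ^+ 2 = dot h (G *m h) by rewrite sqr_sqrtr ?ltW.
have /ereal_sup_ubound : kset 'E_P[fun w => (dot (q^-1 *: h) (Z w).1 ^+ 4)%R]%E.
  exists (q^-1 *: h) => //=; rewrite E2 -scalemxAr dotZl dotZr -q2 lee_fin.
  by rewrite le_eqVlt; apply/orP; left; apply/eqP; field; rewrite gt_eqF.
rewrite -supE E4 lee_fin.
have -> : (fun w => dot (q^-1 *: h) (Z w).1 ^+ 4) =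
    (fun w => (q ^+ 2)^-1 ^+ 2 * dot h (Z w).1 ^+ 4).
  by apply/funext => w; rewrite dotZl exprMn -exprVn -exprM.
rewrite rexpZ; last by have [] := dotX4_moment h.
by rewrite -q2 exprVn mulrC ler_pdivrMr ?exprn_gt0.
Qed.

Let mean_residual4 : has_mean P (fun w => residual Z theta_star w ^+ 4).
Proof.
have := @mean_abs_residual 4.
rewrite (_ : (fun w => _) = (fun w => residual Z theta_star w ^+ 4)).
  by apply; have := p1; lra.
apply/funext => w; rewrite (_ : 4 = 2 * 2%:R :> R); last by rewrite -natrM.
by rewrite abs_powR powR_mulrn ?sqr_ge0// -exprM.
Qed.

Lemma residual4E : rexpectation P (fun w => residual Z theta_star w ^+ 4) =
  kappa2 P Z theta_star * r ^+ 2.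
Proof. by rewrite /kappa2 mulfVK// expf_eq0/= gt_eqF. Qed.

Lemma kappa2_ge0 : 0 <= kappa2 P Z theta_star.
Proof.
rewrite divr_ge0 ?sqr_ge0//; apply: rexp_ge0 => w.
by rewrite (exprM _ 2 2) sqr_ge0.
Qed.

(** The kurtosis of [<u, W>] is at most [K]: Minkowski's inequality in [L^4] separates
    the contribution of [X], with kurtosis [kappa1], from that of the residual, with
    kurtosis [kappa2]. *)
Lemma whitened_fourth_le u :
  rexpectation P (fun w => dot u (whiten (Z w)) ^+ 4) <=
  kappaK P Z theta_star *
    rexpectation P (fun w => dot u (whiten (Z w)) ^+ 2) ^+ 2.
Proof.
have [a [s ->]] := appendP u; rewrite whitened_form.
set h := S *m a; pose c := `|s / Num.sqrt r|.
pose f w : R := `|dot h (Z w).1|; pose g w : R := c * `|residual Z theta_star w|.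
have mf : measurable_fun setT f by apply: measurableT_comp => //; exact: mdot_Z.
have mg : measurable_fun setT g.
  by apply: measurable_funM => //; exact: measurableT_comp.
have f0 w : 0 <= f w by exact: normr_ge0.
have g0 w : 0 <= g w by rewrite mulr_ge0// normr_ge0.
have norm4 (y : R) : `|y| `^ 4 = y ^+ 4.
  by rewrite powR_mulrn// (exprM _ 2 2) real_normK ?num_real// -exprM.
have fE : (fun w => f w `^ 4) = (fun w => dot h (Z w).1 ^+ 4).
  by apply/funext => w; rewrite norm4.
have gE : (fun w => g w `^ 4) = (fun w => c ^+ 4 * residual Z theta_star w ^+ 4).
  apply/funext => w; rewrite powRM ?normr_ge0//; congr (_ * _); last exact: norm4.
  by rewrite powR_mulrn ?normr_ge0.
have If : has_mean P (fun w => f w `^ 4) by rewrite fE; have [] := dotX4_moment h.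
have Ig : has_mean P (fun w => g w `^ 4) by rewrite gE; exact: has_meanZ.
have s41 : 1 <= 4 :> R by lra.
have [Ifg Efg] := rexp_minkowski s41 mf mg f0 g0 If Ig.
have fg4 w : dot (append a s) (whiten (Z w)) ^+ 4 <= (f w + g w) `^ 4.
  rewrite -norm4; apply: ge0_ler_powR; rewrite ?nnegrE ?addr_ge0//.
  by rewrite dot_whiten (le_trans (ler_normD _ _))// normrM.
have Iw : has_mean P (fun w => dot (append a s) (whiten (Z w)) ^+ 4).
  apply: (le_has_mean _ Ifg) => [|w].
    apply: measurable_funX; under eq_fun do rewrite dotE.
    apply: measurable_sum => j; apply: measurable_funM => //.
    exact: (measurableT_comp (measurable_whiten j)).
  by rewrite ger0_norm// (exprM _ 2 2) sqr_ge0.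
apply: (le_trans (ler_rexp Iw Ifg fg4)); apply: (le_trans Efg).
set A := rexpectation P _; set B := rexpectation P (fun w => g w `^ 4).
have A0 : 0 <= A by apply: rexp_ge0 => w; exact: powR_ge0.
have B0 : 0 <= B by apply: rexp_ge0 => w; exact: powR_ge0.
have root4 (y : R) : 0 <= y -> (y `^ 4^-1) ^+ 2 ^+ 2 = y.
  by move=> y0; rewrite -exprM -powR_mulrn ?powR_ge0// -powRrM mulVf// powRr1.
rewrite powR_mulrn ?addr_ge0 ?powR_ge0//.
have k1 := kappa1_ge0; have k2 := kappa2_ge0.
have rootsq (y k q : R) : 0 <= y -> 0 <= k -> 0 <= q -> y <= k * q ^+ 2 ->
    (y `^ 4^-1) ^+ 2 <= Num.sqrt k * q.
  move=> y0 k0 q0 yk.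
  rewrite -(@ler_pXn2r _ 2)// ?nnegrE ?sqr_ge0 ?mulr_ge0 ?sqrtr_ge0//.
  by rewrite root4// exprMn sqr_sqrtr.
apply: quartic_root_bound; rewrite ?sqrtr_ge0 ?powR_ge0 ?sqr_ge0//.
- by apply: rootsq => //; rewrite /A fE; exact: dotX4_le.
- apply: rootsq => //; first exact: sqr_ge0.
  rewrite /B gE rexpZ// residual4E.
  have -> : c ^+ 4 = (s ^+ 2) ^+ 2 / r ^+ 2.
    rewrite /c (exprM _ 2 2) real_normK ?num_real// expr_div_n sr2.
    by rewrite expr_div_n.
  by rewrite le_eqVlt; apply/orP; left; apply/eqP; field; rewrite gt_eqF.
Qed.
End Whitening.

(** * Relative deviation of the empirical quadratic form *)

Section RelativeDeviation.
Context (R : realType) (d : nat) (dT : measure_display) (T : measurableType dT)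
  (P : probability T R) (Z : {RV P >-> sample_space R d})
  (theta_star : 'cV[R]_d) (S : 'M[R]_d) (p eps : R).
Hypotheses (p12 : 1 < p <= 2) (eps01 : 0 < eps < 1)
  (X2fin : ('E_P[fun w => (enorm (Z w).1 ^+ 2)%R] < +oo)%E)
  (Y2fin : ('E_P[fun w => ((Z w).2 ^+ 2)%R] < +oo)%E)
  (minim : argmin (risk P Z) theta_star)
  (r0 : 0 < risk P Z theta_star)
  (hS : is_sqrt_pseudo_inverse (gram P Z) S)
  (rfin : ('E_P[fun w => (`|residual Z theta_star w| `^ (4 * p + 4))%R] < +oo)%E)
  (wfin : ('E_P[fun w => (enorm (S *m (Z w).1) `^ (4 * p + 4))%R] < +oo)%E)
  (K1 : 1 < kappaK P Z theta_star).

Let K := kappaK P Z theta_star.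
Let L := log_dim d eps.
Let p1 : 1 < p. Proof. by case/andP: p12. Qed.
Let p2 : p <= 2. Proof. by case/andP: p12. Qed.
Let eps0 : 0 < eps. Proof. by case/andP: eps01. Qed.

Let W := whiten Z theta_star S.
Let g w : R := dot (W (Z w)) (W (Z w)) `^ (p + 1).

Let moment_bracket : R :=
  (residual_moment P Z theta_star (2 * p + 2) `^ (1 / (p + 1)) / risk P Z theta_star
    + white_moment P Z S (2 * p + 2) `^ (1 / (p + 1))) `^ (p + 1).

Let second_bracket : R :=
  (residual_moment P Z theta_star (4 * p + 4) `^ (1 / (2 * p + 2)) / risk P Z theta_star
    + white_moment P Z S (4 * p + 4) `^ (1 / (2 * p + 2))) `^ (p + 1).

Lemma kappa_root_ge0 : 0 <= kappa_root P Z theta_star.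
Proof. by rewrite addr_ge0// sqrtr_ge0. Qed.

Lemma sqrt_kappaK : Num.sqrt K = kappa_root P Z theta_star.
Proof. by rewrite sqrtr_sqr ger0_norm// kappa_root_ge0. Qed.

Lemma ln_inv_eps_gt0 : 0 < ln eps^-1.
Proof.
by apply: ln_gt0; rewrite -[ltLHS]invr1 ltf_pV2 ?posrE//; case/andP: eps01.
Qed.

Lemma log_dim_gt0 : 0 < L.
Proof.
have := ln_inv_eps_gt0; have d0 : 0 <= d%:R :> R by [].
by rewrite /L /log_dim; lra.
Qed.

Let g_sqr w : g w ^+ 2 = dot (W (Z w)) (W (Z w)) `^ (2 * p + 2).
Proof.
rewrite (_ : 2 * p + 2 = (p + 1) * 2%:R); last by ring.
by rewrite powRrM powR_mulrn ?powR_ge0.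
Qed.

Let Ig2 : has_mean P (fun w => g w ^+ 2).
Proof.
under eq_fun do rewrite g_sqr.
by apply: (whiten_moment r0 rfin wfin _ _).1; have := p1; lra.
Qed.

Let Eg_ge1 : 1 <= rexpectation P g.
Proof. by apply: (whiten_moment_ge1 X2fin Y2fin r0 rfin wfin); have := p1; lra. Qed.

Let Eg2_ge1 : 1 <= rexpectation P (fun w => g w ^+ 2).
Proof.
under [in X in rexpectation _ X]eq_fun do rewrite g_sqr.
by apply: (whiten_moment_ge1 X2fin Y2fin r0 rfin wfin); have := p1; lra.
Qed.

Let B n : R := rexpectation P g +
  Num.sqrt (rexpectation P (fun w => g w ^+ 2) / (n%:R * eps)).

(** Minkowski's inequality at the exponents [p + 1] and [2 p + 2] identifies the two
    terms of [B n] with the two brackets of [gamma_tilde]. *)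
Let B_le n : (0 < n)%N ->
  B n <= moment_bracket + (Num.sqrt (n%:R * eps))^-1 * second_bracket.
Proof.
move=> n0; have nR : 0 < n%:R :> R by rewrite ltr0n.
have p10 : p + 1 != 0 by rewrite gt_eqF//; have := p1; lra.
rewrite lerD//.
  have := (whiten_moment r0 rfin wfin (s := p + 1) _ _).2.
  rewrite (_ : 2 * (p + 1) = 2 * p + 2); last by ring.
  by rewrite /moment_bracket !div1r; apply; have := p1; lra.
have := (whiten_moment r0 rfin wfin (s := 2 * p + 2) _ _).2.
rewrite (_ : 2 * (2 * p + 2) = 4 * p + 4); last by ring.
set b := (X in _ <= X `^ _) => hb.
have b0 : 0 <= b by rewrite addr_ge0 ?divr_ge0 ?powR_ge0// ltW.
have -> : second_bracket = Num.sqrt (b `^ (2 * p + 2)).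
  rewrite -powR12_sqrt ?powR_ge0// -powRrM /second_bracket !div1r -/b.
  by congr (_ `^ _); field.
have ne0 : 0 <= n%:R * eps by rewrite mulr_ge0// ltW.
rewrite sqrtrM; last by rewrite (le_trans _ Eg2_ge1).
rewrite sqrtrV// mulrC ler_wpM2l ?invr_ge0 ?sqrtr_ge0// ler_wsqrtr//.
under [in X in rexpectation _ X]eq_fun do rewrite g_sqr.
by apply: hb; have := p1; lra.
Qed.

Lemma delta_hat_ge0 n : 2 * mu P Z theta_star eps n < 1 ->
  0 <= mu P Z theta_star eps n <= delta_hat P Z theta_star eps n.
Proof.
move=> mu2; have mu0 : 0 <= mu P Z theta_star eps n.
  apply: addr_ge0; first exact: sqrtr_ge0.
  apply: mulr_ge0; last exact: sqrtr_ge0.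
  by apply: mulr_ge0; [lra|exact: kappa_root_ge0].
rewrite mu0 /delta_hat ler_pdivlMr; last by lra.
by rewrite ler_piMr//; lra.
Qed.

Lemma gamma_tilde_ge0 n : 0 <= gamma_tilde P Z theta_star S p eps n.
Proof.
rewrite /gamma_tilde mulr_ge0 ?mulr_ge0 ?powR_ge0//.
  by rewrite invr_ge0; have := p1; lra.
by rewrite addr_ge0 ?mulr_ge0 ?invr_ge0 ?powR_ge0 ?sqrtr_ge0.
Qed.

(** [1 - 2 / k] is at least [1 / 2], which the spare factor 2 in [2 (p + 1)]
    compensates in the moment term. *)
Lemma deviation_le (n : nat) : (0 < n)%N -> 2 * mu P Z theta_star eps n < 1 ->
  let lam := Num.sqrt (2 * L / ((K - 1) * n%:R)) in
  exists2 k : nat, (4 <= k)%N &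
    (lam * (K - 1) / 2 +
      (ln eps^-1 + 4 / 5 * ((k + 2) * (d + 1))%:R) / (n%:R * lam)
      + lam `^ (p + 1 - 1) / (2 * (p + 1)) * B n) / (1 - 2 / k%:R) <=
    mu P Z theta_star eps n + gamma_tilde P Z theta_star S p eps n.
Proof.
move=> n0 mu2 lam; have nR : 0 < n%:R :> R by rewrite ltr0n.
have D1 : 1 <= d%:R + 1 :> R by rewrite lerDr.
have [k k4 dev] := deviation_le_mu K1 D1 nR ln_inv_eps_gt0.
exists k => //; rewrite mulrDl; apply: lerD.
  move: dev; rewrite -/K sqrt_kappaK natrM !natrD; exact.
have k4R : 4 <= k%:R :> R by rewrite ler_nat.
have k2 : 2^-1 <= 1 - 2 / k%:R :> R.
  have : 2 / k%:R <= 2^-1 :> R by rewrite ler_pdivrMr; lra.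
  by lra.
have p10 : 0 < p + 1 by have := p1; lra.
have B0 : 0 <= B n by rewrite addr_ge0 ?sqrtr_ge0// (le_trans _ Eg_ge1).
set c := _ / (2 * (p + 1)) * B n.
have c0 : 0 <= c by rewrite mulr_ge0 ?divr_ge0 ?powR_ge0// mulr_ge0// ltW.
apply: (@le_trans _ _ (2 * c)).
  rewrite ler_pdivrMr; last by lra.
  rewrite mulrAC ler_peMl// -[leLHS](_ : 2 * 2^-1 = 1); first by rewrite ler_wpM2l.
  by rewrite divff.
have lamE : lam `^ (p + 1 - 1) =
    (2 * L / ((K - 1) * n%:R)) `^ (p / 2).
  rewrite addrK /lam -powR12_sqrt; last first.
    rewrite divr_ge0 ?mulr_ge0 ?(ltW log_dim_gt0) ?(ltW nR)//.
    by rewrite subr_ge0 ltW.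
  by rewrite -powRrM [2^-1 * p]mulrC.
have -> : 2 * c = (p + 1)^-1 * lam `^ (p + 1 - 1) * 1 * B n.
  by rewrite /c; field; rewrite gt_eqF.
rewrite /gamma_tilde -/K -/L lamE; apply: ler_pM => //.
- by rewrite mulr1 mulr_ge0 ?invr_ge0 ?powR_ge0// ltW.
- rewrite ler_wpM2l//; first by rewrite mulr_ge0 ?invr_ge0 ?powR_ge0// ltW.
  have /andP[mu0 dh] := delta_hat_ge0 mu2.
  have := @ge0_ler_powR R (p + 1) (ltW p10) 1 (1 + delta_hat P Z theta_star eps n).
  by rewrite powR1; apply; rewrite ?nnegrE; lra.
- exact: B_le.
Qed.

(** The Gram matrix estimate for [whiten], transported by [whitened_vector]. The
    representation of [xi Y_i - <theta, X_i>] holds simultaneously for all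
    [theta] and [xi] as soon as every [X_i] lies in the range of [G]. *)
Lemma relative_deviation (n : nat) (Zs : 'I_n -> {RV P >-> sample_space R d}) :
  independent_copies Zs Z -> (0 < n)%N -> 2 * mu P Z theta_star eps n < 1 ->
  with_probability_at_least P (1 - 3 * eps)
    [set w | forall theta xi, `|emp_quad Zs w theta xi - quad P Z theta xi| <=
      (mu P Z theta_star eps n + gamma_tilde P Z theta_star S p eps n)
        * quad P Z theta xi].
Proof.
move=> copies n0 mu2; have [k k4 dev] := deviation_le n0 mu2.
have K1' : 1 <= kappaK P Z theta_star by exact: ltW.
have lam0 : 0 < Num.sqrt (2 * L / ((K - 1) * n%:R)).
  by rewrite sqrtr_gt0 divr_gt0 ?mulr_gt0 ?log_dim_gt0 ?ltr0n// subr_gt0.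
have q23 : 2 <= p + 1 <= 3 by have := p1; have := p2; lra.
have D0 : (0 < d + 1)%N by rewrite addn1.
have k2 : (2 < k)%N by exact: ltn_trans k4.
have B1 : 1 <= B n by rewrite (le_trans Eg_ge1)// lerDl sqrtr_ge0.
have E2pos : 0 < rexpectation P (fun w => g w ^+ 2) by exact: lt_le_trans Eg2_ge1.
have gram_event := gram_deviation copies n0 D0 (measurable_whiten Z theta_star S)
  q23 K1' lam0 Ig2 (whitened_form_le X2fin Y2fin minim r0 hS)
  (whitened_fourth_le X2fin Y2fin minim r0 hS p1 rfin wfin)
  k2 eps0 (net_cardinal_le k (d + 1) eps0) B1 E2pos.
pose in_range (v : sample_space R d) := v.1 = gram P Z *m (S *m (S *m v.1)).
have m_range : measurable [set v | in_range v].
  have -> : [set v | in_range v] = \bigcap_(j in [set: 'I_d])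
      [set v : sample_space R d | v.1 j 0 = (gram P Z *m (S *m (S *m v.1))) j 0].
    apply/seteqP; split => [v vE j _|v vE]; first by rewrite /= -vE.
    by apply/colP => j; exact: vE.
  apply: fin_bigcap_measurable => // j _.
  pose gap (v : sample_space R d) : R :=
    v.1 j 0 - (gram P Z *m (S *m (S *m v.1))) j 0.
  have mgap : measurable_fun setT gap.
    apply: measurable_funB; first exact: measurable_coord.
    under eq_fun do rewrite entryE !mulmxA dot_mulmx.
    exact: measurable_dot_fst.
  have -> : [set v : sample_space R d | v.1 j 0 = (gram P Z *m (S *m (S *m v.1))) j 0]
      = setT `&` gap @^-1` [set 0].
    apply/seteqP; split => v /=; rewrite /gap; first by move=> ->; rewrite subrr.
    by move=> [_ /eqP]; rewrite subr_eq0 => /eqP.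
  exact: mgap measurableT _ (measurable_set1 _).
have range_event : {ae P, forall w i, in_range (Zs i w)}.
  apply: ae_forall_ord => i; apply: (copies_ae copies i m_range).
  exact: ae_range.
have [A [mA AE PA]] := with_probability_ae gram_event range_event.
exists A; split=> // w Aw theta xi.
have [/= gw rw] := AE _ Aw.
have := gw (whitened_vector Z theta_star S theta xi).
rewrite (whitened_vector_form X2fin Y2fin minim r0 hS).
rewrite (whitened_vector_norm X2fin Y2fin minim r0 hS).
have -> : n%:R^-1 * \sum_i dot (whitened_vector Z theta_star S theta xi)
    (whiten Z theta_star S (Zs i w)) ^+ 2 = emp_quad Zs w theta xi.
  congr (_ * _); apply: eq_bigr => i _.
  by rewrite (dot_whitened_vector r0 hS _ _ (rw i)).
move=> /le_trans; apply; rewrite ler_wpM2r//.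
by apply: rexp_ge0 => v; exact: sqr_ge0.
Qed.

End RelativeDeviation.

(** * Bounds on delta and its order of magnitude *)

Lemma form_quotient_close (R : realType) (a b eta : R) :
  0 <= b -> 0 <= eta -> `|a - b| <= eta * b ->
  (`| form_quotient a b - 1 | <= eta%:E)%E.
Proof.
move=> b0 eta0 ab; rewrite /form_quotient; have [b_eq0|b_neq0] := eqVneq b 0.
  move: ab; rewrite b_eq0 mulr0 subr0 normr_le0 => /eqP ->; rewrite eqxx.
  by rewrite subee// abse0 lee_fin.
have bp : 0 < b by rewrite lt0r b_neq0.
rewrite -EFinB abse_EFin lee_fin.
have -> : a / b - 1 = (a - b) / b by rewrite mulrBl divff.
by rewrite normrM normfV (gtr0_norm bp) ler_pdivrMr.
Qed.

Lemma limsup_ratio_le_near (R : realType) (c : R) (A : nat -> \bar R) (B : nat -> R) :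
  (\forall n \near \oo, (A n * ((B n)^-1)%:E <= c%:E)%E) -> limsup_ratio_le c A B.
Proof.
move=> [N _ AB]; rewrite /limsup_ratio_le limn_esup_lim; apply: lime_le.
  exact: is_cvg_esups.
exists N => // n /= Nn; apply: ge_ereal_sup => _ [m /= nm <-].
by apply: AB; exact: leq_trans nm.
Qed.

Lemma amplitude_numeric (R : realFieldType) (K d l s : R) :
  1 < K -> 1 <= d -> 0 <= l -> K * (d + l) <= 2 * s ->
  2 * (2 * (K - 1) * (l + 73 / 100 * (d + 1))
    + (681 / 100) ^+ 2 * K * (2 * (d + 1))) <= 760 * s.
Proof.
move=> K1 d1 l0; rewrite mulrDr => Ks.
have c2 : (681 / 100) ^+ 2 <= 47 :> R by rewrite expr2; lra.
have Kd : K <= K * d by rewrite ler_peMr//; lra.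
have Kl : 0 <= K * l by apply: mulr_ge0; lra.
have h1 : 2 * (K - 1) * (l + 73 / 100 * (d + 1)) <= 2 * (K * l) + 292 / 100 * (K * d).
  have -> : 2 * (K - 1) * (l + 73 / 100 * (d + 1)) = 2 * (K * l)
    + 146 / 100 * (K * d) + 146 / 100 * K - 2 * (l + 73 / 100 * (d + 1)) by field.
  by lra.
have h2 : (681 / 100) ^+ 2 * K * (2 * (d + 1)) <= 47 * (4 * (K * d)).
  rewrite -mulrA; apply: ler_pM; [exact: sqr_ge0| |exact: c2|].
    by apply: mulr_ge0; lra.
  by rewrite mulrCA mulrDr mulr1; lra.
by lra.
Qed.

Section DeltaBounds.
Context (R : realType) (d : nat) (dT : measure_display) (T : measurableType dT)
  (P : probability T R) (Z : {RV P >-> sample_space R d})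
  (theta_star : 'cV[R]_d) (S : 'M[R]_d) (p eps : R).
Hypotheses (d0 : (0 < d)%N) (p12 : 1 < p <= 2) (eps01 : 0 < eps < 1)
  (r0 : 0 < risk P Z theta_star)
  (k10 : 0 <= kappa1 P Z) (k20 : 0 <= kappa2 P Z theta_star)
  (K1 : 1 < kappaK P Z theta_star).

Let K := kappaK P Z theta_star.
Let L := log_dim d eps.
Let mu_ n := mu P Z theta_star eps n.
Let dh n := delta_hat P Z theta_star eps n.
Let ga n := gamma_tilde P Z theta_star S p eps n.
Let dl n := delta P Z theta_star S p eps n.

(** The denominator of [delta] is at most 1 and [mu <= delta_hat]. *)
Lemma le_delta n : 2 * mu_ n < 1 -> ((mu_ n + ga n)%:E <= dl n)%E.
Proof.
move=> mu2; have /andP[mu0 mudh] := delta_hat_ge0 mu2.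
have ga0 : 0 <= ga n by exact: gamma_tilde_ge0.
rewrite /dl /delta -/(dh n) -/(ga n) -/(mu_ n) in mudh mu0 *.
case: ifPn => [_|D0]; first exact: leey.
have [dh1|dh1] := leP 1 (dh n).
  by move: D0; rewrite [Num.max (1 - dh n) 0]max_r ?subr_le0// mul0r eqxx.
have [ga1|ga1] := leP 1 (ga n).
  by move: D0; rewrite [Num.max (1 - ga n) 0]max_r ?subr_le0// mulr0 eqxx.
rewrite !max_l ?subr_ge0 ?(ltW dh1) ?(ltW ga1)// lee_fin ler_pdivlMr; last first.
  by rewrite mulr_gt0// subr_gt0.
apply: (@le_trans _ _ ((mu_ n + ga n) * 1)); last by rewrite mulr1 lerD2r.
apply: ler_wpM2l; first exact: addr_ge0.
rewrite -[leRHS]mulr1; apply: ler_pM; rewrite ?subr_ge0 ?(ltW dh1) ?(ltW ga1)//.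
  by rewrite lerBlDr lerDl (le_trans mu0).
by rewrite lerBlDr lerDl.
Qed.

(** [mu] is [amp] times [n^(-1/2)]. *)
Let amp : R := Num.sqrt (2 * (K - 1) * L) +
  681 / 100 * kappa_root P Z theta_star * Num.sqrt (2 * (d%:R + 1)).

Let scale : R := (kappa1 P Z + kappa2 P Z theta_star) * (d%:R + ln eps^-1).

Let p1 : 1 < p. Proof. by case/andP: p12. Qed.
Let eps0 : 0 < eps. Proof. by case/andP: eps01. Qed.
Let L0 : 0 < L. Proof. exact: (log_dim_gt0 _ eps01). Qed.
Let l0 : 0 < ln eps^-1. Proof. exact: ln_inv_eps_gt0. Qed.
Let K10 : 0 < K - 1. Proof. by rewrite subr_gt0. Qed.
Let d1 : 1 <= d%:R :> R. Proof. by rewrite ler1n. Qed.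

Let amp_gt0 : 0 < amp.
Proof.
apply: ltr_wpDr; last by rewrite sqrtr_gt0 mulr_gt0// mulr_gt0.
apply: mulr_ge0; last exact: sqrtr_ge0.
by apply: mulr_ge0; [lra|exact: kappa_root_ge0].
Qed.

Let muE n : mu_ n = amp * Num.sqrt (n%:R^-1).
Proof.
rewrite [RHS]mulrDl; congr (_ + _).
  rewrite -sqrtrM; last by rewrite mulr_ge0 ?mulr_ge0// ltW.
  by congr Num.sqrt; rewrite -/K -/L; ring.
by rewrite -[RHS]mulrA -sqrtrM.
Qed.

Let K_le : K <= 2 * (kappa1 P Z + kappa2 P Z theta_star).
Proof.
rewrite /K /kappaK /kappa_root; set a := Num.sqrt _; set b := Num.sqrt (kappa2 _ _ _).
have -> : kappa1 P Z = a ^+ 2 by rewrite sqr_sqrtr.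
have -> : kappa2 P Z theta_star = b ^+ 2 by rewrite sqr_sqrtr.
by have := sqr_ge0 (a - b); rewrite !expr2; lra.
Qed.

Let scale_gt0 : 0 < scale.
Proof.
apply: mulr_gt0; first by have := K_le; have := K10; lra.
by rewrite addr_gt0// (lt_le_trans ltr01).
Qed.

Let amp2_le : amp ^+ 2 <= 760 * scale.
Proof.
have k0 : 0 <= kappa_root P Z theta_star by exact: kappa_root_ge0.
have KE : K = kappa_root P Z theta_star ^+ 2 by [].
set k := kappa_root P Z theta_star in k0 KE *.
rewrite /amp -/k; set x := Num.sqrt _; set y := Num.sqrt (2 * (d%:R + 1)).
have x2 : x ^+ 2 = 2 * (K - 1) * L.
  by rewrite sqr_sqrtr// mulr_ge0 ?mulr_ge0// ltW.
have y2 : y ^+ 2 = 2 * (d%:R + 1) by rewrite sqr_sqrtr// mulr_ge0.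
apply: (@le_trans _ _ (2 * (x ^+ 2 + (681 / 100) ^+ 2 * k ^+ 2 * y ^+ 2))).
  have -> : (681 / 100) ^+ 2 * k ^+ 2 * y ^+ 2 = (681 / 100 * k * y) ^+ 2.
    by rewrite !exprMn.
  move: (681 / 100 * k * y) => z.
  by have := sqr_ge0 (x - z); rewrite !expr2; lra.
rewrite x2 y2 -KE; apply: amplitude_numeric => //; first exact: ltW.
by rewrite /scale mulrA ler_wpM2r// addr_ge0// ltW.
Qed.

Let mu_sqr n : mu_ n ^+ 2 = amp ^+ 2 / n%:R.
Proof. by rewrite muE exprMn sqr_sqrtr// invr_ge0. Qed.

Let mu_gt0 n : (0 < n)%N -> 0 < mu_ n.
Proof. by move=> n0; rewrite muE mulr_gt0// sqrtr_gt0 invr_gt0 ltr0n. Qed.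

Let mu_small : \forall n \near \oo, (0 < n)%N /\ mu_ n <= 1 / 10.
Proof.
near=> n; have n0 : (0 < n)%N by near: n; exact: nbhs_infty_gt.
split=> //; have hn : (10 * amp) ^+ 2 <= n%:R by near: n; exact: nbhs_infty_ger.
rewrite -(@ler_pXn2r _ 2)// ?nnegrE ?(ltW (mu_gt0 n0))// mu_sqr.
rewrite ler_pdivrMr ?ltr0n//; apply: (@le_trans _ _ ((1 / 10) ^+ 2 * (10 * amp) ^+ 2)).
  by rewrite -exprMn mulrA (_ : 1 / 10 * 10 = 1) ?mul1r; [|field].
by rewrite ler_wpM2l// sqr_ge0.
Unshelve. all: by end_near. Qed.

Let dh_le n : (0 < n)%N -> mu_ n <= 1 / 10 ->
  mu_ n <= dh n /\ dh n <= 5 / 4 * mu_ n.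
Proof.
move=> n0 mu10; have mu2 : 2 * mu_ n < 1 by lra.
have /andP[_ mudh] := delta_hat_ge0 mu2; split=> //.
rewrite /dh /delta_hat -/(mu_ n) ler_pdivrMr; last by lra.
have mu0 := mu_gt0 n0; have : 0 <= mu_ n * (1 - 10 * mu_ n).
  by apply: mulr_ge0; [exact: ltW|lra].
by lra.
Qed.

Let b1 : R :=
  (residual_moment P Z theta_star (2 * p + 2) `^ (1 / (p + 1)) / risk P Z theta_star
    + white_moment P Z S (2 * p + 2) `^ (1 / (p + 1))) `^ (p + 1).

Let b2 : R :=
  (residual_moment P Z theta_star (4 * p + 4) `^ (1 / (2 * p + 2)) / risk P Z theta_star
    + white_moment P Z S (4 * p + 4) `^ (1 / (2 * p + 2))) `^ (p + 1).

Let amp_ga : R := (p + 1)^-1 * (2 * L / (K - 1)) `^ (p / 2) * 2 `^ (p + 1)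
  * (b1 + (Num.sqrt eps)^-1 * b2).

Let amp_ga0 : 0 <= amp_ga.
Proof.
have p10 : 0 <= (p + 1)^-1 by rewrite invr_ge0; have := p1; lra.
apply: mulr_ge0; first by rewrite !mulr_ge0 ?powR_ge0.
by rewrite addr_ge0 ?mulr_ge0 ?invr_ge0 ?sqrtr_ge0 ?powR_ge0.
Qed.

Let ga_le n : (0 < n)%N -> 0 <= dh n <= 1 -> ga n <= amp_ga * n%:R^-1 `^ (p / 2).
Proof.
move=> n0 /andP[dh0 dh1]; have nR : 0 < n%:R :> R by rewrite ltr0n.
have p10 : 0 < p + 1 by have := p1; lra.
have -> : ga n = (p + 1)^-1 * (2 * L / ((K - 1) * n%:R)) `^ (p / 2)
  * (1 + dh n) `^ (p + 1) * (b1 + (Num.sqrt (n%:R * eps))^-1 * b2) by [].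
have -> : (2 * L / ((K - 1) * n%:R)) `^ (p / 2) =
    (2 * L / (K - 1)) `^ (p / 2) * n%:R^-1 `^ (p / 2).
  rewrite invfM mulrA powRM ?invr_ge0 ?(ltW nR)//.
  by rewrite divr_ge0 ?mulr_ge0 ?(ltW K10) ?(ltW L0).
rewrite (_ : amp_ga * _ = (p + 1)^-1 * ((2 * L / (K - 1)) `^ (p / 2) * n%:R^-1 `^ (p / 2))
  * 2 `^ (p + 1) * (b1 + (Num.sqrt eps)^-1 * b2)); last by rewrite /amp_ga; ring.
have pos : 0 <= (p + 1)^-1 * ((2 * L / (K - 1)) `^ (p / 2) * n%:R^-1 `^ (p / 2)).
  by rewrite !mulr_ge0 ?powR_ge0// invr_ge0 ltW.
apply: ler_pM.
- by rewrite mulr_ge0 ?powR_ge0.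
- by rewrite addr_ge0 ?mulr_ge0 ?invr_ge0 ?sqrtr_ge0 ?powR_ge0.
- rewrite ler_wpM2l//; apply: ge0_ler_powR; rewrite ?nnegrE; [exact: ltW| | |]; lra.
- rewrite lerD2l ler_wpM2r ?powR_ge0// lef_pV2 ?posrE ?sqrtr_gt0 ?mulr_gt0//.
  by rewrite ler_wsqrtr// ler_peMl ?(ltW eps0)// ler1n.
Qed.

(** [p > 1] makes [n^(-p/2)] negligible with respect to [n^(-1/2)]; the threshold on [n]
    is where [n^((p - 1)/2)] reaches [amp_ga / amp]. *)
Let ga_small : \forall n \near \oo, (0 < n)%N -> amp_ga * n%:R^-1 `^ (p / 2) <= mu_ n.
Proof.
pose e := (p - 1) / 2; have e0 : 0 < e by rewrite divr_gt0 ?subr_gt0.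
near=> n => n0; have nR : 0 < n%:R :> R by rewrite ltr0n.
have nV0 : 0 < n%:R^-1 :> R by rewrite invr_gt0.
have hn : (amp_ga / amp) `^ e^-1 <= n%:R by near: n; exact: nbhs_infty_ger.
have ne : amp_ga / amp <= n%:R `^ e.
  have x0 : 0 <= amp_ga / amp by rewrite divr_ge0 ?(ltW amp_gt0).
  have := ge0_ler_powR (ltW e0) (powR_ge0 _ _ : _ \in Num.nneg)
    (ltW nR : _ \in Num.nneg) hn.
  by rewrite -powRrM mulVf ?gt_eqF// powRr1.
rewrite muE -powR12_sqrt ?(ltW nV0)//.
have -> : p / 2 = e + 2^-1 by rewrite /e; field.
rewrite powRD; last by rewrite (gt_eqF nV0) implybT.
rewrite mulrA ler_wpM2r ?powR_ge0//.
have VE : n%:R^-1 `^ e = (n%:R `^ e)^-1.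
  apply: (@mulIf _ (n%:R `^ e)); first by rewrite gt_eqF// powR_gt0.
  rewrite -powRM ?(ltW nR) ?(ltW nV0)// mulVf ?gt_eqF// powR1 mulVf//.
  by rewrite gt_eqF// powR_gt0.
by rewrite VE ler_pdivrMr ?powR_gt0// mulrC -ler_pdivrMr.
Unshelve. all: by end_near. Qed.

Let regime : \forall n \near \oo,
  [/\ (0 < n)%N, mu_ n <= 1 / 10 & ga n <= dh n].
Proof.
near=> n; have [n0 mu10] : (0 < n)%N /\ mu_ n <= 1 / 10 by near: n; exact: mu_small.
split=> //; have [mudh dhmu] := dh_le n0 mu10; apply: le_trans mudh.
have dh01 : 0 <= dh n <= 1.
  by have := mu_gt0 n0; have [] := dh_le n0 mu10; lra.
apply: le_trans (ga_le n0 dh01) _.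
by move: n0; near: n; exact: ga_small.
Unshelve. all: by end_near. Qed.

Let dl_le n : (0 < n)%N -> mu_ n <= 1 / 10 -> ga n <= dh n ->
  exists2 x : R, dl n = x%:E & 0 <= x <= 3 * dh n.
Proof.
move=> n0 mu10 gadh; have [mudh dhmu] := dh_le n0 mu10.
have dh18 : dh n <= 1 / 8 by lra.
have ga0 : 0 <= ga n by exact: gamma_tilde_ge0.
have dh0 : 0 < dh n by exact: lt_le_trans (mu_gt0 n0) mudh.
have m1 : Num.max (1 - dh n) 0 = 1 - dh n by rewrite max_l//; lra.
have m2 : Num.max (1 - ga n) 0 = 1 - ga n by rewrite max_l//; lra.
have D23 : 2 / 3 <= (1 - dh n) * (1 - ga n).
  apply: (@le_trans _ _ (7 / 8 * (7 / 8))); first by lra.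
  by apply: ler_pM; lra.
exists ((dh n + ga n) / ((1 - dh n) * (1 - ga n))).
  rewrite /dl /delta -/(dh n) -/(ga n) m1 m2 gt_eqF//.
  by apply: lt_le_trans D23; lra.
have D0 : 0 < (1 - dh n) * (1 - ga n) by apply: lt_le_trans D23; lra.
rewrite divr_ge0 ?addr_ge0 ?(ltW dh0) ?(ltW D0)//= ler_pdivrMr//.
have : dh n * (2 / 3) <= dh n * ((1 - dh n) * (1 - ga n)) by rewrite ler_wpM2l// ltW.
by lra.
Qed.

Let rate (n : nat) : R := scale / n%:R.

Let dh_sqr_le n : (0 < n)%N -> mu_ n <= 1 / 10 -> dh n ^+ 2 <= 1200 * rate n.
Proof.
move=> n0 mu10; have [mudh dhmu] := dh_le n0 mu10; have mu0 := mu_gt0 n0.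
have dh0 : 0 < dh n by exact: lt_le_trans mudh.
apply: (@le_trans _ _ ((5 / 4 * mu_ n) ^+ 2)).
  by rewrite lerXn2r ?nnegrE ?(ltW dh0)// (le_trans (ltW dh0)).
have c0 : 0 <= (5 / 4) ^+ 2 :> R by exact: sqr_ge0.
have c1 : (5 / 4) ^+ 2 * 760 <= 1200 :> R by rewrite expr2; lra.
have -> : 1200 * rate n = 1200 * scale / n%:R by exact: mulrA.
have -> : (5 / 4 * mu_ n) ^+ 2 = (5 / 4) ^+ 2 * amp ^+ 2 / n%:R.
  by rewrite exprMn mu_sqr; exact: mulrA.
apply: ler_wpM2r.
  by rewrite invr_ge0.
apply: (le_trans (ler_wpM2l c0 amp2_le)).
rewrite mulrA; apply: ler_wpM2r c1; exact: ltW.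
Qed.

Let rate_gt0 n : (0 < n)%N -> 0 < rate n.
Proof. by move=> n0; rewrite divr_gt0// ltr0n. Qed.

(** For large [n], [mu <= 1 / 10] and [gamma_tilde <= delta_hat], whence
    [delta <= 3 delta_hat] and [delta_hat^2 <= 1200 rate]; and [9 * 1200 <= 11000]. *)
Lemma delta_orders :
  [/\ limsup_ratio_le 11000 (fun n => (dl n * dl n)%E) (fun n => dh n ^+ 2),
      limsup_ratio_le 11000 (fun n => (dh n ^+ 2)%:E) rate
    & limsup_ratio_le 11000 (fun n => (dl n * dl n)%E) rate].
Proof.
have facts : \forall n \near \oo, [/\ 0 < rate n, 0 < dh n ^+ 2,
    dh n ^+ 2 <= 1200 * rate n & exists2 x, dl n = x%:E & x * x <= 9 * dh n ^+ 2].
  apply: filterS regime => n [n0 mu10 gadh]; have [mudh _] := dh_le n0 mu10.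
  have dh0 : 0 < dh n := lt_le_trans (mu_gt0 n0) mudh.
  split; [exact: rate_gt0|exact: exprn_gt0|exact: dh_sqr_le|].
  have [x dlx /andP[x0 x3]] := dl_le n0 mu10 gadh; exists x => //.
  by have := ler_pM x0 x0 x3 x3; rewrite expr2; lra.
split; apply: limsup_ratio_le_near; apply: filterS facts => n [rn dn drn [x dlx xx]].
- by rewrite dlx -!EFinM lee_fin ler_pdivrMr//; lra.
- by rewrite -!EFinM lee_fin ler_pdivrMr//; lra.
- by rewrite dlx -!EFinM lee_fin ler_pdivrMr//; lra.
Qed.

End DeltaBounds.

Theorem proposition4p7 (R : realType) :
  exists c : R,
  forall (d : nat) (dT : measure_display) (T : measurableType dT)
    (P : probability T R) (Z : {RV P >-> sample_space R d})
    (theta_star : 'cV[R]_d) (S : 'M[R]_d) (p eps : R),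
  (0 < d)%N ->
  1 < p <= 2 ->
  0 < eps < 1 ->
  ('E_P[fun w => (enorm (Z w).1 ^+ 2)%R] < +oo)%E ->
  ('E_P[fun w => ((Z w).2 ^+ 2)%R] < +oo)%E ->
  argmin (risk P Z) theta_star ->
  0 < risk P Z theta_star ->
  is_sqrt_pseudo_inverse (gram P Z) S ->
  ('E_P[fun w => (`|residual Z theta_star w| `^ (4 * p + 4))%R] < +oo)%E ->
  ('E_P[fun w => (enorm (S *m (Z w).1) `^ (4 * p + 4))%R] < +oo)%E ->
  1 < kappaK P Z theta_star ->
  let K := kappaK P Z theta_star in
  let dh := delta_hat P Z theta_star eps in
  let dl := delta P Z theta_star S p eps in
  (forall (n : nat) (Zs : 'I_n -> {RV P >-> sample_space R d}),
     independent_copies Zs Z ->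
     (20 * kappa_root P Z theta_star * Num.sqrt (d%:R + 1)
      + (5 / 2 + 1 / (2 * (K - 1)))
        * Num.sqrt (2 * (K - 1) * log_dim d eps)) ^+ 2 < n%:R ->
     with_probability_at_least P (1 - 3 * eps)
       [set w | forall (theta : 'cV[R]_d) (xi : R),
          (`| form_quotient (emp_quad Zs w theta xi) (quad P Z theta xi) - 1 |
             <= dl n)%E]
     /\
     ((dl n < 1)%E ->
      forall theta_hat : T -> 'cV[R]_d,
      (forall w, argmin (sum_squares Zs w) (theta_hat w)) ->
      let dr := fine (dl n) in
      with_probability_at_least P (1 - 3 * eps)
        [set w |
           risk P Z (theta_hat w) - risk P Z theta_star
             <= dr ^+ 2 / ((1 - dr) * (1 - dr ^+ 2) * n%:R)
                * sum_squares Zs w (theta_hat w)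
           /\
           dr ^+ 2 / ((1 - dr) * (1 - dr ^+ 2) * n%:R)
             * sum_squares Zs w (theta_hat w)
             <= dr ^+ 2 / (1 - dr) ^+ 2 * risk P Z theta_star]))
  /\
  (let rate (n : nat) :=
     (kappa1 P Z + kappa2 P Z theta_star) * (d%:R + ln eps^-1) / n%:R in
   [/\ limsup_ratio_le c (fun n => (dl n * dl n)%E) (fun n => dh n ^+ 2),
       limsup_ratio_le c (fun n => (dh n ^+ 2)%:E) rate
     & limsup_ratio_le c (fun n => (dl n * dl n)%E) rate]).
Proof.
exists 11000 => d dT T P Z theta_star S p eps d0 p12 eps01 X2fin Y2fin minim r0 hS
  rfin wfin K1 K dh dl.
have p1 : 1 < p by case/andP: p12.
have k10 := kappa1_ge0 X2fin hS p1 wfin.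
have k20 : 0 <= kappa2 P Z theta_star by exact: kappa2_ge0.
split; last exact: (delta_orders S d0 p12 eps01 k10 k20 K1).
move=> n Zs copies hn.
have n0 : (0 < n)%N by rewrite -(ltr_nat R); apply: le_lt_trans hn; exact: sqr_ge0.
have mu2 : 2 * mu P Z theta_star eps n < 1.
  apply: mu_lt_half hn => //; rewrite ?ltr0n//; first exact: kappa_root_ge0.
  by apply: ltW; exact: log_dim_gt0.
have dev := relative_deviation p12 eps01 X2fin Y2fin minim r0 hS rfin wfin K1
  copies n0 mu2.
have dl_ge := le_delta S p12 mu2.
have /andP[mu0 _] := delta_hat_ge0 mu2.
have eta0 : 0 <= mu P Z theta_star eps n + gamma_tilde P Z theta_star S p eps n.
  by apply: addr_ge0 => //; exact: gamma_tilde_ge0.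
have quad0 theta xi : 0 <= quad P Z theta xi.
  by apply: rexp_ge0 => v; exact: sqr_ge0.
have [A [mA Adev PA]] := dev; split.
  exists A; split=> // w Aw theta xi; apply: le_trans dl_ge.
  by apply: form_quotient_close => //; exact: Adev.
move=> dl1 theta_hat hat_min dr.
have dl_fin : dl n \is a fin_num.
  rewrite ge0_fin_numE ?(lt_trans dl1) ?ltry//; apply: le_trans dl_ge.
  by rewrite lee_fin.
have drE : (dr%:E = dl n)%E by rewrite /dr fineK.
have dr_ge : mu P Z theta_star eps n + gamma_tilde P Z theta_star S p eps n <= dr.
  by rewrite -lee_fin drE.
have dr01 : 0 <= dr < 1 by rewrite (le_trans eta0)//= -lte_fin drE.
exists A; split=> // w Aw /=.
apply: (excess_risk X2fin Y2fin n0 minim (hat_min w) dr01) => theta xi.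
by apply: (le_trans (Adev _ Aw theta xi)); rewrite ler_wpM2r.
Qed.
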